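(* Let $(T_j)_{j\ge1}$, $N$, $m$ and $U$ be as in the context. Suppose that $\mathbb{E}[N]>1$ and that $m(\alpha)=1$ for some $\alpha\in(0,2]$. Let $(Y_t)_{t\ge0}$ be a nondegenerate (not identically zero) complex-valued Lévy process such that $$uY_t \text{ has the same law as } Y_{|u|^\alpha t}\qquad\text{for all }u\in U,\ t>0.$$ Suppose that there is no $U$-invariant $\mathbb{R}$-linear subspace of $\mathbb{C}$ other than $\{0\}$ and $\mathbb{C}$. Then for each $t>0$ the law of $Y_t$ is absolutely continuous with respect to Lebesgue measure on $\mathbb{C}\simeq\mathbb{R}^2$.
   Context: $(T_j)_{j\ge1}$ is a sequence of complex-valued random variables on a common probability space (with arbitrary joint dependence) such that $$N:=\#\{j: T_j\neq 0\}=\max\{j: T_j\neq 0\}<\infty\quad\text{a.s.}$$ Set $m(s):=\mathbb{E}\big[\sum_{j=1}^N|T_j|^s\big]$, so $m(0)=\mathbb{E}[N]$. $U$ denotes the closed multiplicative subgroup of $\mathbb{C}\setminus\{0\}$ generated by the support of $(T_j)_{j\ge1}$, i.e. the smallest closed subgroup of $\mathbb{C}\setminus\{0\}$ such that a.s. $T_j\in U$ for all $1\le j\le N$. A subspace $V\subset\mathbb{C}$ is $U$-invariant if $uV\subset V$ for all $u\in U$. *)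

(* Defs.v *)
From HB Require Import structures.
From mathcomp Require Import all_boot all_order all_algebra.
From mathcomp Require Import complex lra.
From mathcomp Require Import all_classical all_reals all_analysis.

Set Implicit Arguments.
Unset Strict Implicit.
Unset Printing Implicit Defensive.

Import Order.TTheory GRing.Theory Num.Theory.
Import numFieldNormedType.Exports.

Local Open Scope classical_set_scope.
Local Open Scope ring_scope.

(* [R[i]] carries no sigma-algebra in the library: laws on the complex plane
   are laws on R^2 through [plane], with the product Borel sigma-algebra and
   the product Lebesgue measure. The topology is that of [R[i]^o], i.e. the
   one given by the modulus. *)
Section plane.
Context {R : realType}.

Definition modulus (z : R[i]) : R := ComplexField.Normc.normc z.

Definition plane (z : R[i]) : measurableTypeR R * measurableTypeR R :=
  (complex.Re z, complex.Im z).

Definition plane_lebesgue : set (measurableTypeR R * measurableTypeR R) -> \bar R :=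
  (@lebesgue_measure R \x @lebesgue_measure R)%E.

End plane.

Section complex_random_variables.
Context {d : measure_display} {T : measurableType d} {R : realType}.

Definition complex_rv (X : T -> R[i]) := measurable_fun [set: T] (plane \o X).

Definition law (P : probability T R) (X : T -> R[i]) := pushforward P (plane \o X).

Definition same_law (P : probability T R) (X Z : T -> R[i]) :=
  forall A, measurable A -> law P X A = law P Z A.

(* Taking some of the [A i] to be [setT] gives the product rule for every
   subfamily. *)
Definition independent (P : probability T R) (n : nat) (X : 'I_n -> T -> R[i]) :=
  forall A : 'I_n -> set (measurableTypeR R * measurableTypeR R),
    (forall i, measurable (A i)) ->
    P (\bigcap_(i in [set: 'I_n]) ((plane \o X i) @^-1` A i)) =
    (\prod_(i < n) law P (X i) (A i))%E.

End complex_random_variables.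

Section levy_processes.
Context {d : measure_display} {T : measurableType d} {R : realType}.
Variables (P : probability T R) (Y : R -> T -> R[i]).

Definition increment (t : nat -> R) (i : nat) : T -> R[i] :=
  if i is k.+1 then fun w => Y (t k.+1) w - Y (t k) w else Y (t 0%N).

Definition cadlag (f : R -> R[i]) :=
  (forall t, 0 <= t -> (f s : R[i]^o) @[s --> t^'+] --> (f t : R[i]^o)) /\
  (forall t, 0 < t -> cvg ((f s : R[i]^o) @[s --> t^'-])).

(* The values of [Y] at negative times are irrelevant. *)
Record levy_process : Prop := LevyProcess {
  levy_rv : forall t, 0 <= t -> complex_rv (Y t);
  levy_start : {ae P, forall w, Y 0 w = 0};
  levy_independent : forall (n : nat) (t : nat -> R),
    0 <= t 0%N -> (forall i, (i < n)%N -> t i < t i.+1) ->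
    independent P (fun i : 'I_n.+1 => increment t i);
  levy_stationary : forall s t, 0 <= s -> 0 <= t ->
    same_law P (fun w => Y (s + t) w - Y s w) (Y t);
  levy_stochastic_continuity : forall t e, 0 <= t -> 0 < e ->
    P [set w | e < modulus (Y s w - Y t w)]
      @[s --> within [set s | 0 <= s] (nbhs t)] --> 0%E;
  levy_cadlag : {ae P, forall w, cadlag (Y ^~ w)} }.

End levy_processes.

Section weights.
Context {d : measure_display} {T : measurableType d} {R : realType}.
Variable (P : probability T R).
(* [W j] is the j-th weight for [1 <= j]; [W 0] is never used. *)
Variable (W : nat -> T -> R[i]).

Definition nonzero_indices (w : T) : set nat := [set j | (1 <= j)%N /\ W j w != 0].

Definition num_nonzero (w : T) : \bar R := counting (nonzero_indices w).

(* The maximum of the nonzero indices, which is 0 if there are none. *)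
Definition last_nonzero (w : T) : \bar R :=
  ereal_sup [set j%:R%:E | j in 0%N |` nonzero_indices w].

Definition weight_family :=
  (forall j, (1 <= j)%N -> complex_rv (W j)) /\
  {ae P, forall w, num_nonzero w = last_nonzero w /\ (num_nonzero w < +oo)%E}.

Definition moment (s : R) : \bar R :=
  (\int[P]_w \sum_(1 <= j <oo | (j%:R%:E <= num_nonzero w)%E)
     (modulus (W j w) `^ s)%:E)%E.

Definition closed_subgroup (G : set R[i]) :=
  [/\ G 1,
      forall x y, G x -> G y -> G (x * y),
      forall x, G x -> G x^-1 &
      exists2 F : set R[i]^o, closed F & G = F `&` [set z | z != 0]].

Definition contains_weights (G : set R[i]) :=
  {ae P, forall w, forall j, (1 <= j)%N -> (j%:R%:E <= num_nonzero w)%E -> G (W j w)}.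

Definition weight_group : set R[i] :=
  \bigcap_(G in [set G | closed_subgroup G /\ contains_weights G]) G.

End weights.

(* [weight_group] is the smallest closed subgroup that almost surely contains
   all the nonzero weights; the almost sure statement needs the second
   countability of the plane, since the intersection may be uncountable. *)
Section weight_group_theory.
Context {d : measure_display} {T : measurableType d} {R : realType}.

Let box (p : rat * rat * rat) : set R[i] :=
  [set z | `|complex.Re z - ratr p.1.1| < ratr p.2 /\
           `|complex.Im z - ratr p.1.2| < ratr p.2].

Let box_nbhs (O : set R[i]^o) (z : R[i]) : open O -> O z ->
  exists p, box p z /\ box p `<=` O.
Proof.
move=> oO Oz.
have /nbhs_ballP[/= e e0 eO] : nbhs (z : R[i]^o) O by exact: open_nbhs_nbhs.
have [r0 i0] : 0 < complex.Re e /\ complex.Im e = 0.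
  by case: e e0 {eO} => a b; rewrite ltcE /= => /andP[/eqP-> ->].
have r40 : 0 < complex.Re e / 4 by lra.
have [q] := rat_in_itvoo r40; rewrite in_itv /= => /andP[q0 qr].
have aux (x : R) : x - ratr q < x + ratr q by lra.
have [p1] := rat_in_itvoo (aux (complex.Re z)); rewrite in_itv /= => /andP[p1l p1r].
have [p2] := rat_in_itvoo (aux (complex.Im z)); rewrite in_itv /= => /andP[p2l p2r].
exists (p1, p2, q); split.
  by rewrite /box /= !ltr_distl; split; apply/andP; split; lra.
move=> w [/=]; rewrite !ltr_distl => /andP[a1 a2] /andP[b1 b2].
apply: eO; rewrite /ball /= /ball_ /= normc_def ltcE /= i0 eqxx /=.
rewrite -[ltRHS](@ger0_norm _ (complex.Re e)) ?(ltW r0)// -sqrtr_sqr ltr_sqrt; last first.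
  by rewrite exprn_gt0.
have sq_lt (x a r : R) : 0 < r -> x < a + r / 4 -> a - r / 4 < x ->
    forall y, y < a + r / 4 -> a - r / 4 < y -> (x - y) ^+ 2 < r ^+ 2 / 2.
  move=> rp h1 h2 y h3 h4.
  have : 0 < (r / 2 - (x - y)) * (r / 2 + (x - y)) by apply: mulr_gt0; lra.
  have : 0 < r ^+ 2 by exact: exprn_gt0.
  lra.
have h1 : (complex.Re z - complex.Re w) ^+ 2 < complex.Re e ^+ 2 / 2.
  by apply: (sq_lt _ (ratr p1)) => //; lra.
have h2 : (complex.Im z - complex.Im w) ^+ 2 < complex.Re e ^+ 2 / 2.
  by apply: (sq_lt _ (ratr p2)) => //; lra.
move: h1 h2; case: (z) (w) => [z1 z2] [w1 w2] /= *; lra.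
Qed.

Variables (P : probability T R) (W : nat -> T -> R[i]).

Let num_nonzeroP (w : T) :
  num_nonzero W w = last_nonzero W w -> (num_nonzero W w < +oo)%E ->
  forall j, (1 <= j)%N -> (j%:R%:E <= num_nonzero W w)%E -> W j w != 0.
Proof.
rewrite /num_nonzero /counting; case: asboolP => // finA.
set A := nonzero_indices W w in finA *; set n := (X in X%:R%:E) => lastE _.
have leAn j : A j -> (j <= n)%N.
  move=> Aj; rewrite -(@ler_nat R) -lee_fin lastE; apply: ereal_sup_ubound.
  by exists j => //; right.
pose s : seq nat := finmap.enum_fset (fset_set A).
have sE j : (j \in s) = (j \in A) by exact: in_fset_set.
have subA : {subset s <= iota 1 n}.
  move=> j; rewrite sE inE => Aj.
  rewrite mem_iota add1n ltnS leAn // andbT; exact: Aj.1.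
have eqA : s =i iota 1 n.
  apply: (uniq_min_size (finmap.fset_uniq _) subA _).2.
  by rewrite size_iota.
move=> j j1; rewrite lee_fin ler_nat => jn.
have : j \in s by rewrite eqA mem_iota add1n ltnS j1.
by rewrite sE inE => -[].
Qed.

Let punctured_plane : weight_family P W ->
  closed_subgroup [set z : R[i] | z != 0] /\
  contains_weights P W [set z : R[i] | z != 0].
Proof.
move=> [_ WN]; split.
  split => /=; first exact: oner_neq0.
  - by move=> x y x0 y0; rewrite mulf_neq0.
  - by move=> x x0; rewrite invr_eq0.
  - by exists setT; [exact: closedT|rewrite setTI].
by apply: filterS WN => w [wE wfin]; exact: num_nonzeroP.
Qed.

Lemma closed_subgroup_weight_group :
  weight_family P W -> closed_subgroup (weight_group P W).
Proof.
move=> /punctured_plane[cC wC]; split.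
- by move=> G [[]].
- by move=> x y xU yU G GP; have [[_ + _ _] _] := GP; apply; [exact: xU|exact: yU].
- by move=> x xU G GP; have [[_ _ + _] _] := GP; apply; exact: xU.
exists (closure (weight_group P W : set R[i]^o)); first exact: closed_closure.
apply/seteqP; split => z.
  by move=> zU; split; [exact: subset_closure|exact: (zU _ (conj cC wC))].
move=> [zU z0] G GP; have [[_ _ _ [F cF GE]] _] := GP.
rewrite GE; split => //; rewrite [F](closure_id _).1 //.
apply: closure_subset zU => x /(_ _ GP).
by rewrite GE => -[].
Qed.

Lemma contains_weights_weight_group :
  weight_family P W -> contains_weights P W (weight_group P W).
Proof.
move=> /punctured_plane[cC wC].
pose avoided p := exists G, [/\ closed_subgroup G, contains_weights P W G &
  box p `&` G = set0].
have avoidP k : {ae P, forall w, forall p, unpickle k = Some p -> avoided p ->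
    forall j, (1 <= j)%N -> (j%:R%:E <= num_nonzero W w)%E -> ~ box p (W j w)}.
  case E : (unpickle k : option (rat * rat * rat)) => [p|]; last first.
    by apply: aeW.
  have [[G [_ wG pG]]|np] := pselect (avoided p); last first.
    by apply: aeW => w _ [<-].
  rewrite /contains_weights in wG; apply: filterS wG => w wG _ [<-] _ j j1 jN pj.
  suff : (box p `&` G) (W j w) by rewrite pG.
  by split => //; exact: wG.
have /ae_foralln := avoidP.
rewrite /contains_weights in wC *; apply: filterS2 wC => w wC {}avoidP j j1 jN G [cG wG].
have [_ _ _ [F cF GE]] := cG.
apply: contrapT => nG.
have nF : (~` F) (W j w).
  by move=> Fj; apply: nG; rewrite GE; split => //; exact: wC.
have [p [pj pF]] := box_nbhs (closed_openC cF) nF.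
apply: (avoidP (pickle p) p _ _ j j1 jN pj); first exact: pickleK.
exists G; split => //; rewrite -subset0 => z [pz].
by rewrite GE => -[Fz _]; exact: pF pz Fz.
Qed.

Lemma weight_group_sub (G : set R[i]) :
  closed_subgroup G -> contains_weights P W G -> weight_group P W `<=` G.
Proof. by move=> cG wG z; apply. Qed.

End weight_group_theory.

Definition invariant_subspace {R : realType} (U : set R[i]) (V : {pred Rcomplex R}) :=
  GRing.submod_closed V /\ forall u v : R[i], U u -> v \in V -> u * v \in V.

(* Main.v *)
Require Import Defs.
From HB Require Import structures.
From mathcomp Require Import all_boot all_order all_algebra.
From mathcomp Require Import complex ring lra.
From mathcomp Require Import all_classical all_reals all_analysis.
From mathcomp Require Import measurable_realfun.

Set Implicit Arguments.
Unset Strict Implicit.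
Unset Printing Implicit Defensive.

Import Order.TTheory GRing.Theory Num.Theory.
Import numFieldNormedType.Exports.

Local Open Scope classical_set_scope.
Local Open Scope ring_scope.

(** Write M_t(x) for the squared modulus of the characteristic function of Y_t
    at the frequency x. Stationarity and independence of the increments make
    t |-> M_t(x) multiplicative ([levy_char_sqrD]), and the scaling hypothesis
    says M_t(u^* x) = M_(|u|^alpha t)(x) for u in the group U
    ([scale_char_sqr]). U contains a contraction c, |c| < 1: otherwise all
    weights would have modulus one and m(alpha) would equal E[N] > 1
    ([weight_group_contraction]).

    The heart of the matter is that M_1(x) < 1 for every x <> 0
    ([char_sqr_lt1]). If M_1(x) = 1, then M_t(x) = 1 for all t, and by scaling
    exp(i <x, c^n Y_t>) is almost surely constant for every n. For two typical
    values y, y' of Y_t, all the numbers <x, c^n (y - y')> are then multiples of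
    2 pi; they tend to 0, so they vanish eventually, and planar geometry gives
    <x, y - y'> = 0 ([dot_contraction_eq0]). Hence the frequencies with
    M_1(x) = 1 form a real subspace, whose orthogonal complement is
    U-invariant. By irreducibility the subspace, not being 0, is the whole
    plane, so Y_t is deterministic, and then linear in t by stochastic
    continuity; but then Y_t spans an invariant real line, which is absurd.

    By compactness M_1 <= q < 1 on the annulus 1 <= |x| <= 1/|c|. Scaling carries
    this to large frequencies as M_s(x) = O(|x|^(-alpha)) for each s > 0
    ([char_sqr_shell_decay]), and M_t = M_(t/k)^k improves the exponent as much
    as one likes ([char_sqr_lattice_decay]).

    Fourier inversion is replaced by a finite argument that only sees integer
    frequencies. On a square of side 1/n around z0 the trigonometric polynomial
    |sum_k exp(i <k, y - z0>)|^2, with k in {0, .., n-1}^2, is at least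
    cos(1)^2 n^4, while its expectation is at most the sum of |phi(k - l)| over
    k and l, which is O(n^2) by the decay of phi. So the law gives such a square
    a mass O(1/n^2), a constant times its area ([law_box_le]). A finite measure
    that is bounded by a multiple of the area on all dyadic squares is
    absolutely continuous ([cells_dominated]), since Borel sets are
    approximated in measure by unions of dyadic squares of a single level. *)

(** * Domination on dyadic squares implies absolute continuity *)

Section approximation.
Context {d : measure_display} {T : measurableType d} {R : realType}.
Variable nu : {measure set T -> \bar R}.
Hypothesis nu_fin : (nu setT < +oo)%E.
Variable D : set (set T).
Hypothesis mD : D `<=` measurable.
Hypothesis DC : setC_closed D.
Hypothesis DI : setI_closed D.
Hypothesis DT : D setT.

Let nuoo (A : set T) : measurable A -> (nu A < +oo)%E.
Proof. by move=> mA; apply: le_lt_trans nu_fin; apply: le_measure; rewrite ?inE. Qed.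

Definition approximable (A : set T) := measurable A /\
  forall e : R, 0 < e -> exists2 B, D B &
    (nu (A `\` B) < e%:E /\ nu (B `\` A) < e%:E)%E.

(** Proper differences and increasing unions preserve approximability, which is
    all that the pi-lambda theorem asks for; finiteness of [nu] is what turns an
    increasing union into one of its terms up to a small error. *)
Lemma approximable_lambda : lambda_system setT approximable.
Proof.
split => //.
- split; first exact: measurableT.
  by move=> e e0; exists setT => //; rewrite setDv measure0 lte_fin.
- move=> A B _ [mA hA] [mB hB]; split; first exact: measurableD.
  move=> e e0; have e20 : 0 < e / 2 by rewrite divr_gt0.
  have [A' DA' [A1 A2]] := hA _ e20; have [B' DB' [B1 B2]] := hB _ e20.
  have [mA' mB'] := (mD DA', mD DB').
  exists (A' `\` B'); first by rewrite setDE; apply: DI => //; exact: DC.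
  split.
    apply: (@le_lt_trans _ _ (nu ((A `\` A') `|` (B' `\` B)))%E).
      apply: le_measure; rewrite ?inE; [| |].
      + by do !apply: measurableD.
      + by apply: measurableU; apply: measurableD.
      + move=> x [[Ax nBx] nx]; have [A'x|nA'x] := pselect (A' x); last by left.
        by right; split => //; apply: contrapT => nB'x; apply: nx.
    apply: (le_lt_trans (measureU2 _ _ _)); [exact: measurableD|exact: measurableD|].
    by rewrite (splitr e) EFinD lteD.
  apply: (@le_lt_trans _ _ (nu ((A' `\` A) `|` (B `\` B')))%E).
    apply: le_measure; rewrite ?inE; [| |].
    + by do !apply: measurableD.
    + by apply: measurableU; apply: measurableD.
    + move=> x [[Ax nBx] nx]; have [A'x|nA'x] := pselect (A x); last by left.
      by right; split => //; apply: contrapT => nB'x; apply: nx.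
  apply: (le_lt_trans (measureU2 _ _ _)); [exact: measurableD|exact: measurableD|].
  by rewrite (splitr e) EFinD lteD.
- move=> F ndF hF.
  have mF i : measurable (F i) by have [] := hF i.
  have mU : measurable (\bigcup_i F i) by exact: bigcupT_measurable.
  split => // e e0; have e20 : 0 < e / 2 by rewrite divr_gt0.
  have : nu (\bigcup_i F i `\` F n) @[n --> \oo] --> 0%E.
    rewrite -[X in _ --> X](measure0 nu).
    have -> : set0 = \bigcap_n (\bigcup_i F i `\` F n).
      apply/esym; rewrite -subset0 => x /= h.
      have [[i _ Fix] _] := h 0%N I.
      by have [_] := h i I; apply.
    apply: nonincreasing_cvg_mu.
    - by apply: nuoo; exact: measurableD.
    - by move=> i; exact: measurableD.
    - by apply: bigcapT_measurable => i; exact: measurableD.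
    - move=> m n mn; apply/subsetPset; apply: setDS; exact/subsetPset/ndF.
  move=> /fine_cvgP[_ /cvgrPdist_lt/(_ _ e20)[n _ /(_ n (leqnn _))]].
  rewrite /= sub0r normrN ger0_norm ?fine_ge0// => hn.
  have [B DB [B1 B2]] := (hF n).2 _ e20.
  have mB := mD DB.
  exists B => //; split; last first.
    apply: (le_lt_trans _ (lt_trans B2 _)); last by rewrite lte_fin; lra.
    apply: le_measure; rewrite ?inE; [exact: measurableD|exact: measurableD|].
    by move=> x [Bx nx]; split => // Fx; apply: nx; exists n.
  apply: (@le_lt_trans _ _ (nu ((\bigcup_i F i `\` F n) `|` (F n `\` B)))%E).
    apply: le_measure; rewrite ?inE; [exact: measurableD| |].
    - by apply: measurableU; exact: measurableD.
    - by move=> x [Ux nBx]; have [?|?] := pselect (F n x); [right|left].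
  apply: (le_lt_trans (measureU2 _ _ _)); [exact: measurableD|exact: measurableD|].
  rewrite (splitr e) EFinD lteD//.
  by rewrite -[ltLHS]fineK ?lte_fin// ge0_fin_numE//; apply: nuoo; exact: measurableD.
Qed.

Lemma sigma_algebra_approximable : <<s D >> `<=` approximable.
Proof.
apply: lambda_system_subset => //; first exact: approximable_lambda.
move=> A DA; split; first exact: mD.
by move=> e e0; exists A => //; rewrite setDv measure0 lte_fin.
Qed.

End approximation.

Section dyadic_cells.
Context {R : realType}.
Local Notation plane_type := (measurableTypeR R * measurableTypeR R)%type.

(** Index of the half-open dyadic square of side 1/2^n that contains [z]. *)
Definition cell (n : nat) (z : plane_type) : int * int :=
  (Num.floor (2 ^+ n * (z.1 : R)), Num.floor (2 ^+ n * (z.2 : R))).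

(** Unions of squares of one common level. As the partitions refine one another,
    two such sets can be brought to the same level, which makes them an algebra. *)
Definition dyadic : set (set plane_type) :=
  [set A | exists n (S : set (int * int)), A = cell n @^-1` S].

(** A level-[n] index is determined by the level-[n + m] index, so the dyadic
    partitions are nested. *)
Lemma floor_dyadic (n m : nat) (x : R) :
  Num.floor (2 ^+ n * x) =
  Num.floor ((Num.floor (2 ^+ (n + m) * x))%:~R / 2 ^+ m : R).
Proof.
have p0 k : 0 < 2 ^+ k :> R by exact: exprn_gt0.
set y := 2 ^+ (n + m) * x.
have -> : 2 ^+ n * x = y / 2 ^+ m by rewrite /y exprD mulrAC mulfK ?gt_eqF// lt0r_neq0.
apply/esym/floor_def; apply/andP; split.
  rewrite ler_pdivlMr// -[2 ^+ m]/(2%:R ^+ m) -natrX -[X in _ * X]mulrz_nat -intrM ler_int.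
  rewrite floor_ge_int intrM mulrz_nat natrX -ler_pdivlMr//.
  exact: floor_le.
rewrite ltr_pdivrMr//; apply: (le_lt_trans (floor_le _)).
by rewrite -ltr_pdivrMr// floorD1_gt.
Qed.

Lemma cell_refine (n m : nat) : exists h, cell n = h \o cell (n + m).
Proof.
exists (fun s => (Num.floor (s.1%:~R / 2 ^+ m : R), Num.floor (s.2%:~R / 2 ^+ m : R))).
by apply/funext => z; rewrite /cell /= -!floor_dyadic.
Qed.

Lemma dyadic_common (A B : set plane_type) : dyadic A -> dyadic B ->
  exists n S S', A = cell n @^-1` S /\ B = cell n @^-1` S'.
Proof.
move=> [n [S ->]] [m [S' ->]].
have [h hE] := cell_refine n m; have [h' h'E] := cell_refine m n.
exists (n + m)%N, (h @^-1` S), (h' @^-1` S').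
by rewrite [in LHS]hE h'E [(m + n)%N]addnC.
Qed.

Lemma dyadicC : setC_closed dyadic.
Proof. by move=> _ [n [S ->]]; exists n, (~` S); rewrite preimage_setC. Qed.

Lemma dyadicI : setI_closed dyadic.
Proof.
move=> A B dA dB; have [n [S [S' [-> ->]]]] := dyadic_common dA dB.
by exists n, (S `&` S'); rewrite preimage_setI.
Qed.

Lemma dyadicT : dyadic setT.
Proof. by exists 0%N, setT; rewrite preimage_setT. Qed.

Definition mesh_itv (n : nat) (k : int) : set R :=
  `[k%:~R / 2 ^+ n, (k + 1)%:~R / 2 ^+ n[%classic.

Lemma floor_mesh (n : nat) (k : int) (x : R) :
  Num.floor (2 ^+ n * x) = k <-> mesh_itv n k x.
Proof.
have p0 : 0 < 2 ^+ n :> R by exact: exprn_gt0.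
rewrite /mesh_itv /= in_itv /= ler_pdivrMr// ltr_pdivlMr// [x * _]mulrC; split.
  by move=> <-; rewrite floor_le floorD1_gt.
exact: floor_def.
Qed.

Lemma cell1E (n : nat) (s : int * int) :
  cell n @^-1` [set s] = mesh_itv n s.1 `*` mesh_itv n s.2.
Proof.
apply/seteqP; split => -[x y] /=.
  by move=> <- /=; split; exact/floor_mesh.
by case: s => i j /= [/floor_mesh hx /floor_mesh hy]; rewrite /cell /= hx hy.
Qed.

Lemma measurable_cell1 n s : measurable (cell n @^-1` [set s]).
Proof. by rewrite cell1E; apply: measurableX; exact: measurable_itv. Qed.

Lemma lebesgue_cell1 n s : plane_lebesgue (cell n @^-1` [set s]) = ((4 ^+ n)^-1%:E : \bar R).
Proof.
rewrite cell1E.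
transitivity (lebesgue_measure (mesh_itv n s.1) * lebesgue_measure (mesh_itv n s.2) : \bar R)%E.
  by apply: product_measure1E; exact: measurable_itv.
have p0 : 0 < 2 ^+ n :> R by exact: exprn_gt0.
have E k : lebesgue_measure (mesh_itv n k) = ((2 ^+ n)^-1 : R)%:E.
  rewrite lebesgue_measure_itv /= lte_fin ltr_pM2r ?invr_gt0// ltr_int ltrDl ltr01.
  by rewrite -EFinB -mulrBl intrD addrAC subrr add0r mul1r.
by rewrite !E -EFinM -invfM -exprMn -natrM.
Qed.

(** A dyadic set is a countable disjoint union of cells, numbered by [pickle];
    the numbers that do not occur contribute the empty set. *)
Lemma cell_sum (n : nat) (S : set (int * int)) :
  [/\ cell n @^-1` S = \bigcup_k cell n @^-1` [set s | S s /\ pickle s = k],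
      trivIset setT (fun k => cell n @^-1` [set s | S s /\ pickle s = k]) &
      forall k, [set s | S s /\ pickle s = k] = set0 \/
        exists s, [set s | S s /\ pickle s = k] = [set s]].
Proof.
split.
- apply/seteqP; split => [z Sz|z [k _ [Sz _]]] //.
  by exists (pickle (cell n z)).
- by move=> i j _ _ [z [[_ <-] [_ <-]]].
- move=> k; have [[s [Ss sk]]|no] := pselect (exists s, S s /\ pickle s = k).
    right; exists s; apply/seteqP; split => [s' [Ss' s'k]|_ ->] //.
    by apply: (pcan_inj pickleK); rewrite s'k sk.
  by left; rewrite -subset0 => s sP; apply: no; exists s.
Qed.

Lemma measurable_dyadic : dyadic `<=` measurable.
Proof.
move=> _ [n [S ->]]; have [-> _ F] := cell_sum n S.
apply: bigcupT_measurable => k.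
by have [->|[s ->]] := F k; [rewrite preimage_set0|exact: measurable_cell1].
Qed.

Lemma le_dyadic (m1 m2 : {measure set plane_type -> \bar R}) :
  (forall n s, m1 (cell n @^-1` [set s]) <= m2 (cell n @^-1` [set s]))%E ->
  forall A, dyadic A -> (m1 A <= m2 A)%E.
Proof.
move=> le12 A [n [S ->]]; have [-> tF F] := cell_sum n S.
have mF k : measurable (cell n @^-1` [set s | S s /\ pickle s = k]).
  by have [->|[s ->]] := F k; [rewrite preimage_set0|exact: measurable_cell1].
rewrite !measure_semi_bigcup//; [|exact: bigcupT_measurable..].
apply: lee_nneseries => // k _.
by have [->|[s ->]] := F k; [rewrite preimage_set0 !measure0|exact: le12].
Qed.

(** x < a exactly when, at some level, the right end of the dyadic interval
    of x is at most a; for each level this is a dyadic condition. *)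
Lemma dyadic_ray (a : R) (p : plane_type -> R) (i : bool) :
  p = (fun z => if i then z.1 else z.2) ->
  <<s dyadic >> (p @^-1` `]-oo, a[).
Proof.
move=> pE.
have -> : p @^-1` `]-oo, a[ = \bigcup_n
    [set z | ((Num.floor (2 ^+ n * p z) + 1)%:~R <= 2 ^+ n * a)].
  apply/seteqP; split => [z|z [n _]] /=.
    rewrite in_itv /= => za.
    have [n hn] : exists n, (2 ^+ n)^-1 < a - p z.
      have e0 : 0 < a - p z by rewrite subr_gt0.
      have := @cvg_geometric R 1 (2^-1).
      rewrite ger0_norm ?invr_ge0// invf_lt1// ltr1n => /(_ isT).
      move=> /cvgrPdist_lt/(_ _ e0)[n _ /(_ n (leqnn _))].
      rewrite /geometric /= sub0r normrN mul1r exprVn ger0_norm ?invr_ge0 ?exprn_ge0// => hn.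
      by exists n.
    exists n => //=; rewrite intrD1 (le_trans (_ : _ <= 2 ^+ n * p z + 1))//.
      by rewrite lerD2r floor_le.
    have p0 : 0 < 2 ^+ n :> R by exact: exprn_gt0.
    by rewrite -lerBrDl -mulrBr -ler_pdivrMl// mulr1 ltW.
  rewrite in_itv /= intrD1 => h; have p0 : 0 < 2 ^+ n :> R by exact: exprn_gt0.
  by rewrite -(ltr_pM2l p0); apply: lt_le_trans h; rewrite -intrD1 floorD1_gt.
apply: sigma_algebra_bigcup => n; apply: sub_sigma_algebra.
exists n, [set s | ((if i then s.1 else s.2) + 1)%:~R <= 2 ^+ n * a].
by apply/seteqP; split => z /=; rewrite pE; case: (i).
Qed.

Lemma measurable_sub_sigma_dyadic : measurable `<=` <<s dyadic >>.
Proof.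
pose T' := g_sigma_algebraType dyadic.
have m1 : measurable_fun [set: T'] (fst : T' -> measurableTypeR R).
  apply: (measurability _ (RGenInftyO.measurableE R)).
  move=> _ [_ [a ->] <-]; rewrite setTI.
  exact: (@dyadic_ray a fst true).
have m2 : measurable_fun [set: T'] (snd : T' -> measurableTypeR R).
  apply: (measurability _ (RGenInftyO.measurableE R)).
  move=> _ [_ [a ->] <-]; rewrite setTI.
  exact: (@dyadic_ray a snd false).
have m12 := measurable_fun_pair m1 m2.
move=> A mA; have := m12 measurableT _ mA; rewrite setTI.
by rewrite (_ : _ @^-1` A = A)//; apply/seteqP; split => -[x y].
Qed.

End dyadic_cells.

(** The bound passes from cells to dyadic sets by additivity. A null set [A] is
    approximated, in the sum of [mu] and of Lebesgue measure on a box, by a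
    dyadic set [B]: then [B] has small area in the box, hence small [mu]-measure,
    and it carries almost all of [A]. The box makes Lebesgue measure finite, and
    is itself dyadic. *)
Lemma cells_dominated {R : realType}
    (mu : {measure set (measurableTypeR R * measurableTypeR R) -> \bar R}) (C : R) :
  (mu setT < +oo)%E ->
  (forall n s, mu (cell n @^-1` [set s]) <= (C / 4 ^+ n)%:E)%E ->
  forall A, measurable A -> plane_lebesgue A = 0%E -> mu A = 0%E.
Proof.
move=> mufin le_cell A mA A0.
pose leb2 : {measure set (measurableTypeR R * measurableTypeR R) -> \bar R} :=
  (@lebesgue_measure R \x @lebesgue_measure R)%E.
have C0 : 0 <= C.
  have := le_cell 0%N (0, 0); rewrite expr0 divr1 => /(le_trans (measure_ge0 _ _)).
  by rewrite lee_fin.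
pose Cn := NngNum C0.
have le_D B : dyadic B -> (mu B <= C%:E * plane_lebesgue B)%E.
  move=> dB; have := @le_dyadic R mu (mscale Cn leb2) _ B dB; apply=> n s.
  apply: (le_trans (le_cell n s)).
  by rewrite [leRHS](_ : _ = C%:E * plane_lebesgue (cell n @^-1` [set s]))%E// lebesgue_cell1.
pose itv (k : nat) : set R := `[- k%:R, k%:R[%classic.
pose box (k : nat) : set (measurableTypeR R * measurableTypeR R) :=
  itv k `*` itv k.
have mbox k : measurable (box k) by apply: measurableX; exact: measurable_itv.
have dbox k : dyadic (box k).
  exists 0%N, [set s | (- k%:Z <= s.1 < k%:Z) /\ (- k%:Z <= s.2 < k%:Z)].
  have E (x : R) : (x \in `[- k%:R, k%:R[) = (- k%:Z <= Num.floor (2 ^+ 0 * x) < k%:Z).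
    rewrite expr0 mul1r in_itv /= floor_ge_int floor_lt_int.
    by rewrite mulrNz.
  by apply/seteqP; split => -[x y] /=; rewrite /box /= /cell /= -!E.
have box_fin k : (plane_lebesgue (box k) < +oo)%E.
  rewrite /plane_lebesgue /box.
  rewrite [ltLHS](_ : _ = (lebesgue_measure (itv k) * lebesgue_measure (itv k))%E); last first.
    by apply: product_measure1E; exact: measurable_itv.
  rewrite lebesgue_measure_itv /=; case: ifP => _; last by rewrite mul0e ltry.
  by rewrite -EFinB -EFinM ltry.
have box0 k : mu (A `&` box k) = 0%E.
  pose nu := measure_add mu (mrestr leb2 (mbox k)).
  have nuE B : nu B = (mu B + leb2 (B `&` box k))%E by rewrite /nu measure_addE.
  have nufin : (nu setT < +oo)%E by rewrite nuE setTI; apply: lte_add_pinfty; last exact: box_fin.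
  have mono B B' : measurable B -> measurable B' -> B `<=` B' -> (mu B <= mu B')%E.
    by move=> mB mB' BB'; apply: le_measure; rewrite ?inE.
  apply/eqP; rewrite eq_le measure_ge0 andbT; apply/lee_addgt0Pr => e e0.
  rewrite add0e.
  (* [B] has area at most e/(C+1) and misses at most e/(C+1) of [A], so that
     the total error is (C+1) e/(C+1). *)
  have e1 : 0 < e / (C + 1) by rewrite divr_gt0// ltr_wpDl.
  have [_ /(_ _ e1)[B dB []]] := sigma_algebra_approximable nufin
    (@measurable_dyadic R) (@dyadicC R) (@dyadicI R) (@dyadicT R) (measurable_sub_sigma_dyadic mA).
  have mB := measurable_dyadic dB.
  move=> AB BA; have := nuE (A `\` B); have := nuE (B `\` A) => BE AE.
  have {}AB : (mu (A `\` B) <= (e / (C + 1))%:E)%E.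
    by apply: le_trans (ltW AB); rewrite [leRHS]AE leeDl.
  have {BA}BA : (leb2 ((B `\` A) `&` box k) <= (e / (C + 1))%:E)%E.
    by apply: le_trans (ltW BA); rewrite [leRHS]BE leeDr.
  have mBk : measurable (B `&` box k) by exact: measurableI.
  have lebB : (leb2 (B `&` box k) <= (e / (C + 1))%:E)%E.
    apply: le_trans BA.
    apply: (@le_trans _ _ (leb2 (((B `\` A) `&` box k) `|` A))%E).
      apply: le_measure; rewrite ?inE//.
        by apply: measurableU => //; apply: measurableI => //; exact: measurableD.
      by move=> z [Bz kz]; have [Az|Az] := pselect (A z); [right|left].
    apply: (le_trans (measureU2 _ _ _)) => //.
      by apply: measurableI => //; exact: measurableD.
    by rewrite [X in (_ + X)%E]A0 adde0.
  apply: (@le_trans _ _ (mu ((A `\` B) `|` (B `&` box k)))).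
    apply: mono; first exact: measurableI.
      by apply: measurableU => //; exact: measurableD.
    by move=> z [Az kz]; have [Bz|Bz] := pselect (B z); [right|left].
  apply: (le_trans (measureU2 _ _ _)) => //; first exact: measurableD.
  have muB : (mu (B `&` box k) <= (C * (e / (C + 1)))%:E)%E.
    apply: (le_trans (le_D _ (dyadicI dB (dbox k)))).
    by rewrite EFinM; apply: lee_wpmul2l; rewrite ?lee_fin.
  apply: (le_trans (leeD AB muB)).
  rewrite -EFinD lee_fin -{1}[e / _]mul1r -mulrDl addrC mulrCA divff ?mulr1//.
  by rewrite gt_eqF// ltr_wpDl.
have AE : A = \bigcup_k (A `&` box k).
  rewrite -setI_bigcupr; apply/esym/setIidPl => -[x y] _.
  have [k xk] : exists k : nat, Num.max `|x| `|y| < k%:R.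
    by exists (Num.bound (Num.max `|x| `|y|)); rewrite archi_boundP// le_max normr_ge0.
  move: xk; rewrite gt_max => /andP[xk yk]; exists k => //.
  by move: xk yk; rewrite !ltr_norml /box /itv /= !in_itv /= => /andP[/ltW -> ->] /andP[/ltW -> ->].
apply/eqP; rewrite eq_le measure_ge0 andbT AE.
have mAk k : measurable (A `&` box k) by exact: measurableI.
apply: (le_trans (@measure_sigma_subadditive _ _ _ mu _ (fun k => A `&` box k) mAk
  (bigcupT_measurable _ mAk) (@subset_refl _ _))).
rewrite eseries0// => k _ _; exact: box0.
Qed.

(** * Bounded functions of independent random variables *)

Section bounded_observables.
Context {d : measure_display} {T : measurableType d} {R : realType}.
Variable Q : probability T R.

Lemma integrable_bounded (mu : {measure set T -> \bar R}) (f : T -> R) (K : R) :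
  (mu setT < +oo)%E -> measurable_fun setT f -> (forall w, `|f w| <= K) ->
  mu.-integrable setT (EFin \o f).
Proof.
move=> mufin mf fK; apply: measurable_bounded_integrable => //.
exists K; split; first exact: num_real.
by move=> M KM w _; rewrite /= (le_trans (fK w))// ltW.
Qed.

Lemma probability_lty (mu : probability T R) : (mu setT < +oo)%E.
Proof. by rewrite (@probability_setT _ _ _ mu) ltry. Qed.

End bounded_observables.

Section independence.
Context {d : measure_display} {T : measurableType d} {R : realType}.
Variable Q : probability T R.
Lemma Rintegral_distribution {d1} {T1 : measurableType d1} (X : {RV Q >-> T1}) (f : T1 -> R) (K : R) :
  measurable_fun setT f -> (forall z, `|f z| <= K) ->
  \int[distribution Q X]_z f z = \int[Q]_w f (X w).
Proof.
move=> mf fK; rewrite /Rintegral integral_distribution//; first exact/measurable_EFinP.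
apply: (@integrable_bounded _ _ _ Q (f \o X) K) => //; [exact: probability_lty|exact: measurableT_comp|by move=> w /=].
Qed.

(** The joint law agrees with the product of the laws on measurable rectangles,
    hence everywhere, and Fubini applies. *)
Lemma Rintegral_mul_independent {d1 d2} {T1 : measurableType d1} {T2 : measurableType d2}
    (X : {RV Q >-> T1}) (Z : {RV Q >-> T2})
    (f : T1 -> R) (g : T2 -> R) (K : R) :
  (forall A B, measurable A -> measurable B ->
    Q (X @^-1` A `&` Z @^-1` B) = (Q (X @^-1` A) * Q (Z @^-1` B))%E) ->
  measurable_fun setT f -> measurable_fun setT g ->
  (forall z, `|f z| <= K) -> (forall z, `|g z| <= K) ->
  \int[Q]_w (f (X w) * g (Z w)) = (\int[Q]_w f (X w)) * (\int[Q]_w g (Z w)).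
Proof.
move=> ind mf mg fK gK.
have mXZ : measurable_fun setT (fun w => (X w, Z w)) by exact: measurable_fun_pair.
pose XZ : {RV Q >-> (T1 * T2)%type} :=
  HB.pack (fun w => (X w, Z w)) (isMeasurableFun.Build _ _ _ _ _ mXZ).
pose h (p : T1 * T2) := f p.1 * g p.2.
have mh : measurable_fun setT h.
  by apply: measurable_funM; apply: measurableT_comp => //.
have hK p : `|h p| <= K * K by rewrite normrM ler_pM.
rewrite -[LHS]/(\int[Q]_w h (XZ w)) -(Rintegral_distribution XZ mh hK).
rewrite -(Rintegral_distribution X mf fK) -(Rintegral_distribution Z mg gK).
have prodE A : measurable A ->
    (distribution Q X \x distribution Q Z)%E A = distribution Q XZ A.
  apply: product_measure_unique => B C mB mC.
  by rewrite /distribution /pushforward -ind.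
have -> : \int[distribution Q XZ]_p h p =
    \int[(distribution Q X \x distribution Q Z)%E]_p h p.
  by congr fine; apply: eq_measure_integral => A mA _; exact/esym/prodE.
have ih : ((distribution Q X) \x (distribution Q Z))%E.-integrable setT (EFin \o h).
  apply: integrable_bounded hK => //.
  rewrite [ltLHS](_ : _ = (distribution Q X setT * distribution Q Z setT)%E); last first.
    by rewrite -setXTT; exact: product_measure1E.
  by rewrite !(@probability_setT _ _ _ (distribution Q _)) mule1 ltry.
have ig : (distribution Q Z).-integrable setT (EFin \o g).
  by apply: integrable_bounded gK => //; exact: probability_lty.
have if_ : (distribution Q X).-integrable setT (EFin \o f).
  by apply: integrable_bounded fK => //; exact: probability_lty.
rewrite {1}/Rintegral -(integral12_prod_meas1 ih) /fubini_F /h /=.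
rewrite -RintegralZr//; congr fine; apply: eq_integral => x _.
rewrite EFinM /Rintegral fineK; last exact: integrable_fin_num.
by rewrite -integralZl//; apply: eq_integral => y _; rewrite -EFinM.
Qed.

End independence.

(** * The squared modulus of a characteristic function *)

Section pairing.
Context {R : realType}.
Implicit Types x y z u : R[i].

(** The Euclidean scalar product on the plane, for which multiplication by [u]
    and by its conjugate are adjoint ([dotMr]). *)
Definition dot x z : R := complex.Re x * complex.Re z + complex.Im x * complex.Im z.

Lemma dotDl x y z : dot (x + y) z = dot x z + dot y z.
Proof. by case: x y z => [? ?] [? ?] [? ?]; rewrite /dot /=; ring. Qed.

Lemma dotDr x y z : dot x (y + z) = dot x y + dot x z.
Proof. by case: x y z => [? ?] [? ?] [? ?]; rewrite /dot /=; ring. Qed.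

Lemma dotNl x z : dot (- x) z = - dot x z.
Proof. by case: x z => [? ?] [? ?]; rewrite /dot /=; ring. Qed.

Lemma dotNr x z : dot x (- z) = - dot x z.
Proof. by case: x z => [? ?] [? ?]; rewrite /dot /=; ring. Qed.

Lemma dotBl x y z : dot (x - y) z = dot x z - dot y z.
Proof. by rewrite dotDl dotNl. Qed.

Lemma dotBr x y z : dot x (y - z) = dot x y - dot x z.
Proof. by rewrite dotDr dotNr. Qed.

Lemma dotMr x u z : dot x (u * z) = dot (conjc u * x) z.
Proof. by case: x u z => [? ?] [? ?] [? ?]; rewrite /dot /=; ring. Qed.

Lemma dotZr (a : R) x (z : Rcomplex R) : dot x (a *: z : Rcomplex R) = a * dot x z.
Proof.
case: x z => [x1 x2] [z1 z2].
rewrite -[(a *: _ : Rcomplex R)]/((a * z1) +i* (a * z2))%C /dot /=; ring.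
Qed.

Lemma dot0l z : dot 0 z = 0.
Proof. by rewrite /dot /= !mul0r addr0. Qed.

Lemma measurable_dot x :
  measurable_fun setT
    (fun p : measurableTypeR R * measurableTypeR R =>
       complex.Re x * p.1 + complex.Im x * p.2 : R).
Proof.
by apply: measurable_funD; apply: measurable_funM.
Qed.

End pairing.

Section characteristic_function.
Context {d : measure_display} {T : measurableType d} {R : realType}.
Variable Q : probability T R.
Implicit Types (X Z : T -> R[i]) (x y : R[i]).

(** Real and imaginary parts of the characteristic function of [X] at [x]. *)
Definition char_cos X x : R := \int[Q]_w cos (dot x (X w)).
Definition char_sin X x : R := \int[Q]_w sin (dot x (X w)).

Definition char_sqr X x : R := char_cos X x ^+ 2 + char_sin X x ^+ 2.

Let Qfin : (Q setT < +oo)%E. Proof. exact: probability_lty. Qed.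

Lemma Rintegral_probability_cst (r : R) : \int[Q]_w r = r.
Proof.
rewrite Rintegral_cst//; have := probability_setT Q => /= QT.
by rewrite [X in fine X]QT mulr1.
Qed.

Lemma measurable_dot_rv X x : complex_rv X ->
  measurable_fun setT (fun w => dot x (X w)).
Proof. by move=> mX; exact: (measurableT_comp (measurable_dot x) mX). Qed.

Lemma measurable_cos_dot X x : complex_rv X ->
  measurable_fun setT (fun w => cos (dot x (X w))).
Proof.
move=> mX; apply: measurableT_comp; last exact: measurable_dot_rv.
by apply: continuous_measurable_fun; exact: continuous_cos.
Qed.

Lemma measurable_sin_dot X x : complex_rv X ->
  measurable_fun setT (fun w => sin (dot x (X w))).
Proof.
move=> mX; apply: measurableT_comp; last exact: measurable_dot_rv.
by apply: continuous_measurable_fun; exact: continuous_sin.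
Qed.

Lemma integrable_cos_dot X x : complex_rv X ->
  Q.-integrable setT (EFin \o (fun w => cos (dot x (X w)))).
Proof.
move=> mX; apply: (@integrable_bounded _ _ _ Q _ 1) => //.
  exact: measurable_cos_dot.
by move=> w; exact: cos_max.
Qed.

Lemma integrable_sin_dot X x : complex_rv X ->
  Q.-integrable setT (EFin \o (fun w => sin (dot x (X w)))).
Proof.
move=> mX; apply: (@integrable_bounded _ _ _ Q _ 1) => //.
  exact: measurable_sin_dot.
by move=> w; exact: sin_max.
Qed.

Lemma integrableR_cst (r : R) : Q.-integrable setT (EFin \o (fun=> r)).
Proof. by apply: (@integrable_bounded _ _ _ Q _ `|r|). Qed.

Lemma integrableRD (f g : T -> R) : Q.-integrable setT (EFin \o f) ->
  Q.-integrable setT (EFin \o g) -> Q.-integrable setT (EFin \o (fun w => f w + g w)).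
Proof.
move=> hf hg; rewrite (_ : _ \o _ = (EFin \o f) \+ (EFin \o g))%E; first exact: integrableD.
by [].
Qed.

Lemma integrableRZ (r : R) (f : T -> R) : Q.-integrable setT (EFin \o f) ->
  Q.-integrable setT (EFin \o (fun w => r * f w)).
Proof.
move=> hf; rewrite (_ : _ \o _ = (fun w => r%:E * (EFin \o f) w))%E; last by [].
exact: integrableZl.
Qed.

Lemma Rintegral_trig_comb X x (a b : R) : complex_rv X ->
  \int[Q]_w (a * cos (dot x (X w)) + b * sin (dot x (X w))) =
  a * char_cos X x + b * char_sin X x.
Proof.
move=> mX; have hc := integrable_cos_dot x mX; have hs := integrable_sin_dot x mX.
by rewrite RintegralD ?RintegralZl//; exact: integrableRZ.
Qed.

Lemma char_sqr_ge0 X x : 0 <= char_sqr X x.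
Proof. by rewrite addr_ge0// sqr_ge0. Qed.

(** The variance of exp(i <x, X>). *)
Lemma Rintegral_char_dist X x : complex_rv X ->
  \int[Q]_w ((char_cos X x - cos (dot x (X w))) ^+ 2 +
             (char_sin X x - sin (dot x (X w))) ^+ 2) = 1 - char_sqr X x.
Proof.
move=> mX; set c := char_cos X x; set s := char_sin X x.
have E w : (c - cos (dot x (X w))) ^+ 2 + (s - sin (dot x (X w))) ^+ 2 =
    (char_sqr X x + 1) + ((- 2 * c) * cos (dot x (X w)) + (- 2 * s) * sin (dot x (X w))).
  by have := cos2Dsin2 (dot x (X w)); rewrite /char_sqr -/c -/s; lra.
under eq_Rintegral do rewrite E.
have hc := integrable_cos_dot x mX; have hs := integrable_sin_dot x mX.
rewrite RintegralD//; last 2 first.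
- exact: integrableR_cst.
- by apply: integrableRD; apply: integrableRZ.
rewrite Rintegral_probability_cst Rintegral_trig_comb// -/c -/s /char_sqr -/c -/s; ring.
Qed.

(** A variance is nonnegative. *)
Lemma char_sqr_le1 X x : complex_rv X -> char_sqr X x <= 1.
Proof.
move=> mX; rewrite -subr_ge0 -Rintegral_char_dist//.
by apply: Rintegral_ge0 => w _; rewrite addr_ge0// sqr_ge0.
Qed.

(** A random variable with zero variance is almost surely constant. *)
Lemma char_sqr_eq1 X x : complex_rv X -> char_sqr X x = 1 ->
  {ae Q, forall w, cos (dot x (X w)) = char_cos X x /\ sin (dot x (X w)) = char_sin X x}.
Proof.
move=> mX M1; have := Rintegral_char_dist x mX; rewrite M1 subrr.
set f := fun w => _ => f0.
have mf : measurable_fun setT f.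
  by apply: measurable_funD; apply: measurable_funX; apply: measurable_funB => //;
    [exact: measurable_cos_dot|exact: measurable_sin_dot].
have f_ge0 w : 0 <= f w by rewrite addr_ge0// sqr_ge0.
have : (\int[Q]_w `|(f w)%:E| = 0)%E.
  under eq_integral do rewrite gee0_abs ?lee_fin//.
  rewrite -[LHS]fineK; last first.
    apply: integrable_fin_num => //.
    have hc := integrable_cos_dot x mX; have hs := integrable_sin_dot x mX.
    apply: (@integrable_bounded _ _ _ Q f 8) => // w; rewrite ger0_norm// /f.
    have sq (a b : R) : `|a| <= 1 -> `|b| <= 1 -> (a - b) ^+ 2 <= 4.
      by rewrite !ler_norml => /andP[? ?] /andP[? ?]; nra.
    have le1 (a b : R) : a ^+ 2 + b ^+ 2 = 1 -> `|a| <= 1 /\ `|b| <= 1.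
      by move=> ab; split; rewrite ler_norml; apply/andP; split; nra.
    have [c1 s1] := le1 _ _ M1.
    by have := sq _ _ c1 (cos_max (dot x (X w))); have := sq _ _ s1 (sin_max (dot x (X w))); lra.
  by congr EFin; exact: f0.
move=> /(ae_eq_integral_abs Q measurableT _).1 h.
have {}h : ae_eq Q setT (EFin \o f) (cst 0%E) by apply: h; exact/measurable_EFinP.
apply: filterS h => w /(_ I)[] /eqP.
rewrite paddr_eq0 ?sqr_ge0// !sqrf_eq0 !subr_eq0 => /andP[/eqP -> /eqP ->].
by [].
Qed.


Lemma same_law_char_sqr X Z x : complex_rv X -> complex_rv Z -> same_law Q X Z ->
  char_sqr X x = char_sqr Z x.
Proof.
move=> mX mZ XZ.
pose X' : {RV Q >-> (measurableTypeR R * measurableTypeR R)%type} :=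
  HB.pack (plane \o X) (isMeasurableFun.Build _ _ _ _ _ mX).
pose Z' : {RV Q >-> (measurableTypeR R * measurableTypeR R)%type} :=
  HB.pack (plane \o Z) (isMeasurableFun.Build _ _ _ _ _ mZ).
have E (g : R -> R) : continuous g -> (forall r, `|g r| <= 1) ->
    \int[Q]_w g (dot x (X w)) = \int[Q]_w g (dot x (Z w)).
  move=> cg g1; have mg := measurableT_comp (continuous_measurable_fun cg) (measurable_dot x).
  have EX := Rintegral_distribution X' mg (fun p => g1 _).
  have EZ := Rintegral_distribution Z' mg (fun p => g1 _).
  rewrite -[LHS]EX -[RHS]EZ; congr fine.
  by apply: eq_measure_integral => A mA _; exact: XZ.
rewrite /char_sqr /char_cos /char_sin (E cos) ?(E sin)//.
- exact: continuous_sin.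
- exact: sin_max.
- exact: continuous_cos.
- exact: cos_max.
Qed.

Lemma char_sqrM X u x : char_sqr (fun w => u * X w) x = char_sqr X (conjc u * x).
Proof.
by rewrite /char_sqr /char_cos /char_sin; congr (_ ^+ 2 + _ ^+ 2);
  apply: eq_Rintegral => w _; rewrite dotMr.
Qed.

Lemma char_sqr0 X : char_sqr X 0 = 1.
Proof.
rewrite /char_sqr /char_cos /char_sin.
under eq_Rintegral do rewrite dot0l cos0.
under [in X in _ + X]eq_Rintegral do rewrite dot0l sin0.
by rewrite !Rintegral_probability_cst expr1n expr0n addr0.
Qed.

Lemma char_sqr_cst X x (k : R) : {ae Q, forall w, dot x (X w) = k} -> complex_rv X ->
  char_sqr X x = 1.
Proof.
move=> hk mX.
have E (g : R -> R) : continuous g -> \int[Q]_w g (dot x (X w)) = g k.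
  move=> cg; rewrite -[RHS]Rintegral_probability_cst; congr fine.
  apply: ae_eq_integral => //.
  - apply/measurable_EFinP; apply: measurableT_comp; last exact: measurable_dot_rv.
    exact: continuous_measurable_fun.
  - by apply: filterS hk => w -> _.
rewrite /char_sqr /char_cos /char_sin !E ?cos2Dsin2//.
- exact: continuous_sin.
- exact: continuous_cos.
Qed.

(** The addition formulas multiply the characteristic functions as complex
    numbers; only the squared moduli are needed. *)
Lemma char_sqr_independent X Z x : complex_rv X -> complex_rv Z ->
  (forall A B, measurable A -> measurable B ->
    Q ((plane \o X) @^-1` A `&` (plane \o Z) @^-1` B) = (law Q X A * law Q Z B)%E) ->
  char_sqr (fun w => X w + Z w) x = char_sqr X x * char_sqr Z x.
Proof.
move=> mX mZ ind.
pose X' : {RV Q >-> (measurableTypeR R * measurableTypeR R)%type} :=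
  HB.pack (plane \o X) (isMeasurableFun.Build _ _ _ _ _ mX).
pose Z' : {RV Q >-> (measurableTypeR R * measurableTypeR R)%type} :=
  HB.pack (plane \o Z) (isMeasurableFun.Build _ _ _ _ _ mZ).
have mg (g : R -> R) (cg : continuous g) :=
  measurableT_comp (continuous_measurable_fun cg) (measurable_dot x).
have E (f g : R -> R) : continuous f -> continuous g ->
    (forall r, `|f r| <= 1) -> (forall r, `|g r| <= 1) ->
    \int[Q]_w (f (dot x (X w)) * g (dot x (Z w))) =
    (\int[Q]_w f (dot x (X w))) * (\int[Q]_w g (dot x (Z w))).
  move=> cf cg f1 g1.
  exact: (@Rintegral_mul_independent _ _ _ Q _ _ _ _ X' Z' _ _ 1 ind (mg f cf) (mg g cg)
    (fun p => f1 _) (fun p => g1 _)).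
have cc := @continuous_cos R; have cs := @continuous_sin R.
have c1 := @cos_max R; have s1 := @sin_max R.
have I (f g : R -> R) : continuous f -> continuous g ->
    (forall r, `|f r| <= 1) -> (forall r, `|g r| <= 1) ->
    Q.-integrable setT (EFin \o (fun w => f (dot x (X w)) * g (dot x (Z w)))).
  move=> cf cg f1 g1; apply: (@integrable_bounded _ _ _ Q _ (1 * 1)) => //.
    apply: measurable_funM; apply: measurableT_comp; try exact: measurable_dot_rv.
      exact: continuous_measurable_fun.
    exact: continuous_measurable_fun.
  by move=> w; rewrite normrM ler_pM.
have C : char_cos (fun w => X w + Z w) x =
    char_cos X x * char_cos Z x - char_sin X x * char_sin Z x.
  rewrite /char_cos /char_sin -!E// -RintegralB//; try exact: I.
  by apply: eq_Rintegral => w _; rewrite dotDr cosD.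
have S : char_sin (fun w => X w + Z w) x =
    char_sin X x * char_cos Z x + char_cos X x * char_sin Z x.
  rewrite /char_cos /char_sin -!E// -RintegralD//; try exact: I.
  by apply: eq_Rintegral => w _; rewrite dotDr sinD.
by rewrite /char_sqr C S; ring.
Qed.

End characteristic_function.

(** * Concentration on small squares *)

Section square_summable_weight.
Context {R : realType}.

(** A summable profile over the integers: products of two of them dominate the
    characteristic function on the lattice. *)
Definition weight (y : R) : R := (1 + y ^+ 2)^-1.

Lemma weight_ge0 y : 0 <= weight y.
Proof. by rewrite invr_ge0 addr_ge0// sqr_ge0. Qed.

Lemma weightN y : weight (- y) = weight y.
Proof. by rewrite /weight sqrrN. Qed.

(** Telescoping: 1/(1+m^2) <= 2/m - 2/(m+1) for m >= 1. *)
Lemma sum_weight (n : nat) : \sum_(0 <= j < n) weight j%:R <= 3.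
Proof.
case: n => [|n]; first by rewrite big_geq.
suff : \sum_(0 <= j < n.+1) weight j%:R <= 3 - 2 / n.+1%:R.
  by move=> /le_trans; apply; rewrite lerBlDr lerDl divr_ge0.
elim: n => [|n IHn]; first by rewrite big_nat1 /weight mulr0n expr0n addr0 invr1; lra.
rewrite big_nat_recr//=; apply: (le_trans (lerD IHn (lexx _))).
rewrite /weight -addrA lerD2l -subr_ge0 opprD opprK.
rewrite -[n.+2]addn1 natrD; set m := n.+1%:R.
have m0 : 1 <= m by rewrite /m ler1n.
rewrite (_ : _ + _ = (m ^+ 2 - m + 2) / ((1 + m ^+ 2) * m * (m + 1))).
  by rewrite divr_ge0//; nra.
field; rewrite !gt_eqF//; nra.
Qed.

(** Split at [l = k]; each half is a sum of [weight] over distinct naturals. *)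
Lemma sum_weight_shift (n k : nat) : (k <= n)%N ->
  \sum_(l < n) weight (k%:R - l%:R) <= 6.
Proof.
move=> kn; rewrite -(big_mkord xpredT (fun l => weight (k%:R - l%:R))).
rewrite (big_cat_nat (leq0n k) kn)/= (_ : 6 = 3 + 3); last by lra.
apply: lerD.
  rewrite big_nat_rev /= add0n.
  apply: (le_trans _ (sum_weight k.+1)).
  rewrite big_nat_recl//= -[leLHS]add0r lerD ?weight_ge0//.
  rewrite le_eqVlt; apply/orP; left; apply/eqP/eq_big_nat => i /andP[_ ik].
  by rewrite -natrB ?leq_subr// subKn.
rewrite -{1}[k]add0n big_addn.
rewrite (eq_bigr (fun i => weight i%:R)) ?sum_weight// => i _.
by rewrite -weightN opprB natrD addrK.
Qed.

End square_summable_weight.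

Section concentration.
Context {d : measure_display} {T : measurableType d} {R : realType}.
Variable Q : probability T R.
Implicit Types (X : T -> R[i]) (x : R[i]).

Lemma Rintegral_bigsum (I : Type) (s : seq I) (h : I -> T -> R) :
  (forall i, Q.-integrable setT (EFin \o h i)) ->
  Q.-integrable setT (EFin \o (fun w => \sum_(i <- s) h i w)) /\
  \int[Q]_w (\sum_(i <- s) h i w) = \sum_(i <- s) \int[Q]_w h i w.
Proof.
move=> ih; elim: s => [|i s [IH1 IH2]].
  have E : (fun w : T => \sum_(i <- [::]) h i w) = fun=> 0.
    by apply/funext => w; rewrite big_nil.
  by rewrite E big_nil Rintegral_probability_cst; split => //; exact: integrableR_cst.
have E : (fun w : T => \sum_(j <- i :: s) h j w) = fun w => h i w + \sum_(j <- s) h j w.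
  by apply/funext => w; rewrite big_cons.
by rewrite E big_cons -IH2 -RintegralD//; split => //; exact: integrableRD.
Qed.

(** This expectation is the real part of exp(-iv) phi(x), so it is at most
    |phi(x)|. *)
Lemma Rintegral_cosB_le X x (v b : R) : complex_rv X -> 0 <= b ->
  char_sqr Q X x <= b ^+ 2 -> \int[Q]_w cos (dot x (X w) - v) <= b.
Proof.
move=> mX b0 cb.
have -> : \int[Q]_w cos (dot x (X w) - v) = char_cos Q X x * cos v + char_sin Q X x * sin v.
  rewrite [RHS](_ : _ = cos v * char_cos Q X x + sin v * char_sin Q X x); last by ring.
  rewrite -Rintegral_trig_comb//.
  by apply: eq_Rintegral => w _; rewrite cosB; ring.
move: cb; rewrite /char_sqr; move: (char_cos _ _ _) (char_sin _ _ _) => c s cb.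
rewrite leNgt; apply/negP => hb.
have : b ^+ 2 < (c * cos v + s * sin v) ^+ 2 by rewrite ltr_pXn2r// nnegrE ?(le_trans b0 (ltW hb)).
apply/negP; rewrite -leNgt; apply: le_trans cb.
have := cos2Dsin2 v; move: (cos v) (sin v) => a e ae.
rewrite -subr_ge0 (_ : _ - _ = (c * e - s * a) ^+ 2) ?sqr_ge0//.
have -> : c ^+ 2 + s ^+ 2 = (c ^+ 2 + s ^+ 2) * (a ^+ 2 + e ^+ 2) by rewrite ae mulr1.
ring.
Qed.

(** Both sides are |sum_k exp(i a_k)|^2: the double sum is nonnegative although
    its terms are not. *)
Lemma sum_sqr_cosB (I : finType) (a : I -> R) :
  \sum_(k : I) \sum_(l : I) cos (a k - a l) =
  (\sum_(k : I) cos (a k)) ^+ 2 + (\sum_(k : I) sin (a k)) ^+ 2.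
Proof.
rewrite !expr2 !big_distrlr /= -big_split /=; apply: eq_bigr => k _.
by rewrite -big_split /=; apply: eq_bigr => l _; rewrite cosB.
Qed.

Definition lattice_point (n : nat) (k : 'I_n * 'I_n) : R[i] := (k.1%:R +i* k.2%:R)%C.

(** The nonnegative trigonometric polynomial |sum_k exp(i <k, X - x0>)|^2, with
    k running through an n x n grid, is of its maximal order n^4 on the box and
    has expectation at most the sum over k and l of |phi(k - l)|, which is
    O(n^2). *)
Lemma law_box_le X (B : R) (n : nat) (x0 : R[i])
    (A : set (measurableTypeR R * measurableTypeR R)) :
  complex_rv X -> (0 < n)%N -> 0 <= B ->
  (forall k l : int, char_sqr Q X (k%:~R +i* l%:~R)%C <=
    (B * (weight k%:~R * weight l%:~R)) ^+ 2) ->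
  measurable A ->
  (forall z, A z -> `|(z.1 : R) - complex.Re x0| <= (2 * n%:R)^-1 /\
                    `|(z.2 : R) - complex.Im x0| <= (2 * n%:R)^-1) ->
  (law Q X A <= (36 * B / cos 1 ^+ 2 / n%:R ^+ 2)%:E)%E.
Proof.
move=> mX n0 B0 XB mA Abox.
have nR0 : 0 < n%:R :> R by rewrite ltr0n.
pose xi := @lattice_point n.
pose F w := \sum_(k : 'I_n * 'I_n) \sum_(l : 'I_n * 'I_n)
  cos (dot (xi k - xi l) (X w) - dot (xi k - xi l) x0).
have FE w : F w = (\sum_(k : 'I_n * 'I_n) cos (dot (xi k) (X w - x0))) ^+ 2 +
                  (\sum_(k : 'I_n * 'I_n) sin (dot (xi k) (X w - x0))) ^+ 2.
  rewrite -sum_sqr_cosB; apply: eq_bigr => k _; apply: eq_bigr => l _.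
  by rewrite -dotBr dotBl.
have F0 w : 0 <= F w by rewrite FE addr_ge0// sqr_ge0.
have icos k l : Q.-integrable setT
    (EFin \o (fun w => cos (dot (xi k - xi l) (X w) - dot (xi k - xi l) x0))).
  apply: (@integrable_bounded _ _ _ Q _ 1) => //; first exact: probability_lty.
    apply: measurableT_comp; first by apply: continuous_measurable_fun; exact: continuous_cos.
    by apply: measurable_funB; [exact: measurable_dot_rv|exact: measurable_cst].
  by move=> w; exact: cos_max.
have [iF IF] := Rintegral_bigsum (index_enum _) (fun k => (Rintegral_bigsum (index_enum _) (icos k)).1).
have FB : \int[Q]_w F w <= 36 * B * n%:R ^+ 2.
  rewrite /F IF.
  under eq_bigr do rewrite (Rintegral_bigsum _ (icos _)).2.
  apply: (@le_trans _ _ (\sum_(k : 'I_n * 'I_n) B * (6 * 6))).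
    apply: ler_sum => k _.
    apply: (@le_trans _ _ (\sum_(l : 'I_n * 'I_n)
        B * (weight (k.1%:R - l.1%:R) * weight (k.2%:R - l.2%:R)))).
      apply: ler_sum => l _; apply: Rintegral_cosB_le => //.
        by rewrite mulr_ge0// mulr_ge0// weight_ge0.
      have := XB (k.1%:Z - l.1%:Z) (k.2%:Z - l.2%:Z).
      by rewrite !intrB.
    rewrite -mulr_sumr ler_wpM2l//.
    rewrite -(pair_bigA _ (fun a b : 'I_n =>
      weight (k.1%:R - a%:R) * weight (k.2%:R - b%:R))) /=.
    rewrite -big_distrlr /=.
    have w0 (i : 'I_n) : 0 <= \sum_(j < n) weight (i%:R - j%:R) :> R.
      by apply: sumr_ge0 => j _; exact: weight_ge0.
    have w6 (i : 'I_n) : \sum_(j < n) weight (i%:R - j%:R) <= 6 :> R.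
      by apply: sum_weight_shift; exact: ltnW.
    exact: ler_pM.
  rewrite sumr_const card_prod card_ord -[_ *+ (n * n)]mulr_natr natrM.
  by rewrite le_eqVlt; apply/orP; left; apply/eqP; ring.
(* On the box |<k, X - x0>| <= 1 because both coordinates of X - x0 are at most
   1/(2n) and those of k are less than n; so each cosine is at least cos 1. *)
pose c : R := (n%:R ^+ 2 * cos 1) ^+ 2.
have c1 : 0 < cos 1 :> R := cos1_gt0 R.
have c0 : 0 < c by rewrite exprn_gt0// mulr_gt0// exprn_gt0.
have cF w : A (plane (X w)) -> c <= F w.
  move=> /Abox /= [h1 h2]; rewrite FE -[leLHS]addr0 lerD ?sqr_ge0//.
  have nc : n%:R ^+ 2 * cos 1 <= \sum_(k : 'I_n * 'I_n) cos (dot (xi k) (X w - x0)).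
    apply: (@le_trans _ _ (\sum_(k : 'I_n * 'I_n) cos 1)).
      by rewrite sumr_const card_prod card_ord -[_ *+ (n * n)]mulr_natl natrM expr2.
    apply: ler_sum => k _; rewrite -[leRHS]cos_norm.
    have k1 : `|dot (xi k) (X w - x0)| <= 1.
      have E : dot (xi k) (X w - x0) = k.1%:R * (complex.Re (X w) - complex.Re x0) +
          k.2%:R * (complex.Im (X w) - complex.Im x0).
        by case: (X w) (x0) => [? ?] [? ?].
      have b (i : 'I_n) (r : R) : `|r| <= (2 * n%:R)^-1 -> `|i%:R * r| <= 2^-1.
        move=> hr; rewrite normrM normr_nat.
        apply: (@le_trans _ _ (n%:R * (2 * n%:R)^-1)).
          by apply: ler_pM; rewrite ?ler_nat ?(ltnW (ltn_ord i)).
        by rewrite le_eqVlt; apply/orP; left; apply/eqP; field; rewrite gt_eqF.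
      rewrite E (le_trans (ler_normD _ _))//.
      have := b k.1 _ h1; have := b k.2 _ h2; lra.
    have pi1 : 1 <= pi :> R by rewrite (le_trans _ (pi_ge2 R))// ler1n.
    rewrite leNgt ltr_cos -?leNgt//; rewrite in_itv /= ?normr_ge0 ?ler01//=.
    exact: le_trans k1 pi1.
  by rewrite ler_pXn2r// nnegrE ?(le_trans _ nc)// mulr_ge0// ?exprn_ge0// ltW.
have mXA : measurable ((plane \o X) @^-1` A).
  by rewrite -[X in measurable X]setTI; exact: mX.
have : (c%:E * law Q X A <= (36 * B * n%:R ^+ 2)%:E)%E.
  have -> : (c%:E * law Q X A = \int[Q]_(w in (plane \o X) @^-1` A) c%:E)%E.
    by rewrite integral_cst.
  apply: (@le_trans _ _ (\int[Q]_(w in (plane \o X) @^-1` A) (F w)%:E)%E).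
    apply: ge0_le_integral => //.
    - by move=> w _; rewrite lee_fin ltW.
    - by apply: measurable_funTS; exact: (measurable_int Q iF).
  apply: (@le_trans _ _ (\int[Q]_w (F w)%:E)%E).
    apply: ge0_subset_integral => //.
      exact: (measurable_int Q iF).
    by move=> w _; rewrite lee_fin.
  rewrite -[leLHS]fineK ?lee_fin//; last exact: integrable_fin_num.
rewrite -lee_pdivlMl// => /le_trans; apply.
rewrite -EFinM lee_fin /c le_eqVlt; apply/orP; left; apply/eqP.
field.
by rewrite !gt_eqF.
Qed.

End concentration.

(** * Absolute continuity from decay, and continuity in the frequency *)

Section lattice_decay.
Context {d : measure_display} {T : measurableType d} {R : realType}.
Variable Q : probability T R.
Implicit Types (X : T -> R[i]).

(** A dyadic square of level [n] is a box for the grid of size [2 ^ n], centred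
    at the midpoint of the square. *)
Lemma lattice_decay_dominated X (B : R) : complex_rv X -> 0 <= B ->
  (forall k l : int, char_sqr Q X (k%:~R +i* l%:~R)%C <=
    (B * (weight k%:~R * weight l%:~R)) ^+ 2) ->
  law Q X `<< plane_lebesgue.
Proof.
move=> mX B0 XB.
pose X' : {RV Q >-> (measurableTypeR R * measurableTypeR R)%type} :=
  HB.pack (plane \o X) (isMeasurableFun.Build _ _ _ _ _ mX).
apply/(@null_content_dominatesP _ _ _ _ (@lebesgue_measure R \x @lebesgue_measure R)%E).
apply: (@cells_dominated R (distribution Q X') (36 * B / cos 1 ^+ 2)).
  exact: probability_lty.
move=> n s.
have p0 : 0 < 2 ^+ n :> R by exact: exprn_gt0.
have -> : 4 ^+ n = ((2 ^ n)%N%:R) ^+ 2 :> R.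
  by rewrite natrX -exprM mulnC exprM; congr (_ ^+ _); lra.
pose c (k : int) : R := (k%:~R + 2^-1) / 2 ^+ n.
apply: (@law_box_le _ _ _ Q X B (2 ^ n)%N (c s.1 +i* c s.2)%C) => //.
- by rewrite expn_gt0.
- exact: measurable_cell1.
rewrite cell1E => -[z1 z2] /= [].
have E k z : mesh_itv n k z -> `|z - c k| <= (2 * (2 ^ n)%N%:R)^-1.
  rewrite /mesh_itv /= in_itv /= => /andP[h1 /ltW h2].
  have e0 : (2 * (2 ^ n)%N%:R)^-1 = 2^-1 / 2 ^+ n :> R by rewrite natrX invfM.
  move: h2; rewrite intrD ler_norml e0 /c !mulrDl => h2; apply/andP.
  move: h1 h2; rewrite mul1r; set y := (2 ^+ n)^-1; lra.
by move=> /E h1 /E h2.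
Qed.

End lattice_decay.

Section continuity.
Context {d : measure_display} {T : measurableType d} {R : realType}.
Variable Q : probability T R.
Variable X : T -> R[i].
Hypothesis mX : complex_rv X.

Let char_lim (g : R -> R) (a_ b_ : nat -> R) (a b : R) :
  continuous g -> (forall r, `|g r| <= 1) ->
  a_ n @[n --> \oo] --> a -> b_ n @[n --> \oo] --> b ->
  (\int[Q]_w g (dot (a_ n +i* b_ n)%C (X w))) @[n --> \oo] -->
  \int[Q]_w g (dot (a +i* b)%C (X w)).
Proof.
move=> cg g1 aa bb.
have mg x : measurable_fun setT (EFin \o (fun w => g (dot x (X w)))).
  apply/measurable_EFinP; apply: measurableT_comp; last exact: measurable_dot_rv.
  exact: continuous_measurable_fun.
have [] := @dominated_convergence _ T R Q setT measurableT
  (fun n w => (g (dot (a_ n +i* b_ n)%C (X w)))%:E)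
  (fun w => (g (dot (a +i* b)%C (X w)))%:E) (cst 1%E).
- by move=> n; exact: mg.
- exact: mg.
- apply: aeW => w _; apply: cvg_EFin; first by apply: nearW.
  apply: continuous_cvg; first exact: cg.
  by apply: cvgD; apply: cvgM => //; exact: cvg_cst.
- exact: (integrableR_cst Q 1).
- by apply: aeW => w n _; rewrite lee_fin.
move=> ig _ h; apply: fine_cvg; rewrite fineK; last exact: integrable_fin_num.
exact: h.
Qed.

(** A failure of continuity would show along a sequence, and along sequences
    dominated convergence applies. *)
Lemma char_sqr_continuous :
  continuous (fun p : R * R => char_sqr Q X (p.1 +i* p.2)%C).
Proof.
move=> p; apply/cvgrPdist_lt => e e0; apply: contrapT => nP.
have /choice[u uP] : forall n : nat, exists q : R * R, ball p (n.+1%:R^-1) q /\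
    ~ (`|char_sqr Q X (p.1 +i* p.2)%C - char_sqr Q X (q.1 +i* q.2)%C| < e).
  move=> n.
  apply: contrapT => no; apply: nP.
  apply: (filterS _ (@nbhsx_ballx R (R * R)%type p n.+1%:R^-1 _)); last by rewrite invr_gt0.
  by move=> q pq /=; apply: contrapT => nq; apply: no; exists q.
have cvgu (v : nat -> R) (r : R) :
    (forall n, `|r - v n| < n.+1%:R^-1) -> v n @[n --> \oo] --> r.
  move=> h; apply/cvgrPdist_lt => f f0.
  near=> n; apply: (lt_trans (h n)).
  by near: n; exact: (near_infty_natSinv_lt (PosNum f0)).
have u1 : (u n).1 @[n --> \oo] --> p.1 by apply: cvgu => n; have [[]] := uP n.
have u2 : (u n).2 @[n --> \oo] --> p.2 by apply: cvgu => n; have [[]] := uP n.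
have : char_sqr Q X ((u n).1 +i* (u n).2)%C @[n --> \oo] --> char_sqr Q X (p.1 +i* p.2)%C.
  apply: cvgD; rewrite ?expr2.
    by apply: cvgM; apply: char_lim => //; [exact: continuous_cos|exact: cos_max|
      exact: continuous_cos|exact: cos_max].
  by apply: cvgM; apply: char_lim => //; [exact: continuous_sin|exact: sin_max|
      exact: continuous_sin|exact: sin_max].
move=> /cvgrPdist_lt/(_ _ e0)[n _ /(_ n (leqnn _))] /= hn.
by have [_] := uP n; apply.
Unshelve. all: by end_near.
Qed.

(** The maximum over a compact annulus is attained, away from 0. *)
Lemma char_sqr_annulus (L : R) : 1 <= L ->
  (forall x, x != 0 -> char_sqr Q X x < 1) ->
  exists q, [/\ 0 <= q, q < 1 & forall a b : R, 1 <= a ^+ 2 + b ^+ 2 <= L ^+ 2 ->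
    char_sqr Q X (a +i* b)%C <= q].
Proof.
move=> L1 lt1.
pose A : set (R * R) := (`[- L, L]%classic `*` `[- L, L]%classic) `&`
  ((fun p => p.1 ^+ 2 + p.2 ^+ 2) @^-1` [set r | 1 <= r]).
have cA : compact A.
  apply: compact_closedI; first by apply: compact_setX; exact: segment_compact.
  apply: closed_comp; last exact: closed_ge.
  move=> p _; apply: cvgD; rewrite !expr2; apply: cvgM; try exact: cvg_fst; exact: cvg_snd.
have A0 : A !=set0.
  exists (1, 0); split; first by split; rewrite /= in_itv /=; apply/andP; split; lra.
  by rewrite /= expr1n expr0n addr0.
have [] := compact_EVT_max A0 cA (continuous_subspaceT char_sqr_continuous).
move=> [c1 c2]; rewrite inE => -[_ /= c12] maxc.
exists (char_sqr Q X (c1 +i* c2)%C); split; first exact: char_sqr_ge0.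
  apply: lt1; apply/eqP => -[c10 c20]; move: c12; rewrite c10 c20 expr0n addr0.
  by rewrite ler10.
move=> a b /andP[ab1 abL]; apply: (maxc (a, b)); rewrite inE; split => //=.
have L0 : 0 <= L by exact: le_trans L1.
by split; rewrite /= in_itv /= -ler_norml -ler_sqr ?nnegrE// real_normK ?num_real//;
  have := sqr_ge0 a; have := sqr_ge0 b; lra.
Qed.

End continuity.

(** * Complex contractions and the real pairing *)

Section modulus.
Context {R : realType}.
Implicit Types x z u v : R[i].

Lemma modulus_sqr z : modulus z ^+ 2 = complex.Re z ^+ 2 + complex.Im z ^+ 2.
Proof. by case: z => a b; rewrite /modulus /= sqr_sqrtr// addr_ge0// sqr_ge0. Qed.

Lemma modulus_ge0 z : 0 <= modulus z.
Proof. by case: z => a b; exact: sqrtr_ge0. Qed.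

Lemma modulusM u z : modulus (u * z) = modulus u * modulus z.
Proof. exact: ComplexField.Normc.normcM. Qed.

Lemma modulus_eq0 z : (modulus z == 0) = (z == 0).
Proof.
by apply/eqP/eqP => [/ComplexField.Normc.eq0_normc//|->]; rewrite /modulus ComplexField.Normc.normc0.
Qed.

Lemma modulus_gt0 z : (0 < modulus z) = (z != 0).
Proof. by rewrite lt_def modulus_ge0 andbT modulus_eq0. Qed.

Lemma modulus1 : modulus (1 : R[i]) = 1.
Proof. exact: ComplexField.Normc.normc1. Qed.

Lemma modulusX u n : modulus (u ^+ n) = modulus u ^+ n.
Proof. by elim: n => [|n IH]; rewrite ?modulus1// !exprS modulusM IH. Qed.

Lemma modulusV u : u != 0 -> modulus u^-1 = (modulus u)^-1.
Proof.
move=> u0; apply: (@mulfI _ (modulus u)); first by rewrite modulus_eq0.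
by rewrite -modulusM !divff ?modulus_eq0// modulus1.
Qed.

Lemma modulus_conj u : modulus (conjc u) = modulus u.
Proof. by case: u => a b; rewrite /modulus /= sqrrN. Qed.

Lemma dot_le_modulus x z : `|dot x z| <= modulus x * modulus z.
Proof.
rewrite -ler_sqr ?nnegrE ?mulr_ge0 ?modulus_ge0// real_normK ?num_real//.
rewrite exprMn !modulus_sqr /dot; case: x z => [a b] [c e] /=.
rewrite -subr_ge0 (_ : _ - _ = (a * e - b * c) ^+ 2) ?sqr_ge0//; ring.
Qed.

Lemma dotxx x : dot x x = modulus x ^+ 2.
Proof. by rewrite modulus_sqr /dot !expr2. Qed.

Lemma cos_eq1_small (y : R) : `|y| < pi -> cos y = 1 -> y = 0.
Proof.
move=> ypi; rewrite -cos_norm -cos0 => h; apply/eqP; rewrite -normr_eq0; apply/eqP.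
apply: (@cos_inj R) => //; rewrite in_itv /= ?normr_ge0 ?lexx ?pi_ge0//.
exact: ltW.
Qed.

(** The numbers <x, u^n v> are multiples of 2 pi and tend to 0, so two
    consecutive ones vanish. If [u] is not real, then u^n v is orthogonal to the
    two independent directions of x and u^* x, so v = 0; if [u] is real, then
    <x, u^n v> is a nonzero multiple of <x, v>. *)
Lemma dot_contraction_eq0 x u v : u != 0 -> modulus u < 1 ->
  (forall n, cos (dot x (u ^+ n * v)) = 1) -> dot x v = 0.
Proof.
move=> u0 u1 h.
have [n hn] : exists n, modulus x * modulus v * modulus u ^+ n < pi.
  have : (modulus x * modulus v * modulus u ^+ n) @[n --> \oo] --> (0 : R).
    by apply: cvg_geometric; rewrite ger0_norm ?modulus_ge0.
  move=> /cvgrPdist_lt/(_ pi (pi_gt0 R))[n _ /(_ n (leqnn _))] /=.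
  rewrite sub0r normrN => hn; exists n; apply: le_lt_trans hn; exact: ler_norm.
have small m : (n <= m)%N -> dot x (u ^+ m * v) = 0.
  move=> nm; apply: cos_eq1_small => //; apply: le_lt_trans hn.
  apply: (le_trans (dot_le_modulus _ _)).
  rewrite modulusM modulusX mulrCA mulrC ler_wpM2l ?mulr_ge0 ?modulus_ge0//.
  by rewrite ler_wiXn2l// ?modulus_ge0// ltW.
have := small n (leqnn n); have := small n.+1 (leqnSn n).
rewrite exprS -mulrA; set z := u ^+ n * v => hu hz.
have [ub|ub] := eqVneq (complex.Im u) 0.
  have uE : u = ((complex.Re u)%:C)%C by case: (u) ub => a b /= ->.
  have uX : u ^+ n = ((complex.Re u ^+ n)%:C)%C by rewrite uE /= -rmorphXn.
  move: hz; rewrite /z uX /dot; case: (v) (x) => [v1 v2] [x1 x2] /=.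
  rewrite !mul0r subr0 addr0 => hz.
  have : complex.Re u ^+ n * (x1 * v1 + x2 * v2) = 0 by rewrite -hz; ring.
  move=> /eqP; rewrite mulf_eq0 expf_eq0 => /orP[/andP[_ /eqP ur]|/eqP//].
  by move: u0; rewrite uE ur eqxx.
have xz : (modulus x * modulus z) ^+ 2 = 0.
  rewrite exprMn !modulus_sqr; move: hu hz ub; rewrite /dot.
  case: (u) (z) (x) => [a b] [c e] [x1 x2] /= hu hz b0.
  have h0 : b * (x2 * c - x1 * e) = 0.
    by rewrite (_ : _ * _ = (x1 * (a * c - b * e) + x2 * (a * e + b * c)) -
      a * (x1 * c + x2 * e)); [rewrite hu hz; ring|ring].
  have /eqP h1 : x2 * c - x1 * e == 0.
    by move/eqP: h0; rewrite mulf_eq0 (negbTE b0).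
  rewrite (_ : _ * _ = (x1 * c + x2 * e) ^+ 2 + (x2 * c - x1 * e) ^+ 2); last by ring.
  by rewrite hz h1; ring.
move/eqP: xz; rewrite sqrf_eq0 mulf_eq0 !modulus_eq0 => /orP[/eqP ->|].
  exact: dot0l.
by rewrite /z mulf_eq0 expf_eq0 (negbTE u0) andbF /= => /eqP ->; rewrite /dot !mulr0 addr0.
Qed.

End modulus.

(** * Almost sure constants and characteristic functions of Levy processes *)

Section almost_sure.
Context {d : measure_display} {T : measurableType d} {R : realType}.
Variable Q : probability T R.
Implicit Types (X Z : T -> R[i]).

Lemma complex_rvD X Z : complex_rv X -> complex_rv Z -> complex_rv (fun w => X w + Z w).
Proof.
move=> /measurable_fun_pairP[X1 X2] /measurable_fun_pairP[Z1 Z2].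
apply/measurable_fun_pairP; split.
  rewrite (_ : _ \o _ = (fst \o (plane \o X)) \+ (fst \o (plane \o Z))).
    exact: measurable_funD.
  by apply/funext => w /=; case: (X w) (Z w) => [? ?] [? ?].
rewrite (_ : _ \o _ = (snd \o (plane \o X)) \+ (snd \o (plane \o Z))).
  exact: measurable_funD.
by apply/funext => w /=; case: (X w) (Z w) => [? ?] [? ?].
Qed.

Lemma complex_rvM (u : R[i]) X : complex_rv X -> complex_rv (fun w => u * X w).
Proof.
move=> /measurable_fun_pairP[X1 X2].
have cM (a b : R) : measurable_fun setT
    ((cst a \* (fst \o (plane \o X))) \+ (cst b \* (snd \o (plane \o X)))).
  by apply: measurable_funD; apply: measurable_funM => //; exact: measurable_cst.
apply/measurable_fun_pairP; split.
  rewrite [X in measurable_fun _ X](_ : _ = (cst (complex.Re u) \* (fst \o (plane \o X))) \+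
     (cst (- complex.Im u) \* (snd \o (plane \o X)))); first exact: cM.
  by apply/funext => w /=; case: (X w) (u) => [? ?] [? ?] /=; ring.
rewrite [X in measurable_fun _ X](_ : _ = (cst (complex.Im u) \* (fst \o (plane \o X))) \+
   (cst (complex.Re u) \* (snd \o (plane \o X)))); first exact: cM.
by apply/funext => w /=; case: (X w) (u) => [? ?] [? ?] /=; ring.
Qed.

Lemma complex_rvB X Z : complex_rv X -> complex_rv Z -> complex_rv (fun w => X w - Z w).
Proof.
move=> mX /(complex_rvM (-1)) mZ; rewrite (_ : (fun w => _) = fun w => X w + -1 * Z w).
  exact: complex_rvD.
by apply/funext => w; rewrite mulN1r.
Qed.

Lemma ae_exists (A : T -> Prop) : {ae Q, forall w, A w} -> exists w, A w.
Proof.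
move=> [N [mN N0 AN]]; apply: contrapT => no.
have : N = setT.
  by rewrite -subTset => w _; apply: AN => /= Aw; apply: no; exists w.
by move=> NT; move: N0; rewrite NT (@probability_setT _ _ _ Q) => /eqP; rewrite onee_eq0.
Qed.

Lemma ae_measure1 (A : set T) : measurable A -> {ae Q, forall w, A w} -> Q A = 1%E.
Proof.
move=> mA hA; have : Q (~` A) = 0%E.
  by apply/negligibleP; [exact: measurableC|exact: hA].
move=> h; rewrite -[X in Q X]setCK probability_setC; last exact: measurableC.
by rewrite h sube0.
Qed.

Lemma measurable_modulus_gt X (e : R) : complex_rv X -> 0 <= e ->
  measurable [set w | e < modulus (X w)].
Proof.
move=> mX e0; rewrite (_ : [set w | _] = (fun w => dot (X w) (X w)) @^-1` `]e ^+ 2, +oo[).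
  have /measurable_fun_pairP[X1 X2] := mX.
  have mf : measurable_fun setT (fun w => dot (X w) (X w)).
    by apply: measurable_funD; apply: measurable_funM.
  by rewrite -[X in measurable X]setTI; apply: mf => //; exact: measurable_itv.
by apply/seteqP; split => w /=; rewrite in_itv /= andbT dotxx ltr_pXn2r ?nnegrE ?modulus_ge0.
Qed.

Lemma measurable_plane1 (c : R[i]) : measurable [set plane c].
Proof.
rewrite (_ : [set plane c] = [set (complex.Re c : measurableTypeR R)] `*`
    [set (complex.Im c : measurableTypeR R)]).
  by apply: measurableX; exact: measurable_set1.
by apply/seteqP; split => -[a b] /= [] -> ->.
Qed.

Lemma plane_inj : injective (@plane R).
Proof. by case=> [a b] [a' b'] [-> ->]. Qed.

Lemma ae_cstP X (c : R[i]) : complex_rv X ->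
  {ae Q, forall w, X w = c} <-> law Q X [set plane c] = 1%E.
Proof.
move=> mX.
have mXc : measurable ((plane \o X) @^-1` [set plane c]).
  by rewrite -[X in measurable X]setTI; apply: mX => //; exact: measurable_plane1.
have E w : ((plane \o X) @^-1` [set plane c]) w <-> X w = c.
  by split => [/plane_inj|/= ->].
rewrite /law /pushforward; split => [Xc|Xc].
  by apply: ae_measure1 => //; apply: filterS Xc => w /= ->.
exists (~` ((plane \o X) @^-1` [set plane c])); split.
- exact: measurableC.
- by rewrite probability_setC// Xc subee.
- by move=> w /= nw /E; exact: nw.
Qed.

Lemma same_law_ae_cst X Z (c : R[i]) : complex_rv X -> complex_rv Z ->
  same_law Q X Z -> {ae Q, forall w, Z w = c} -> {ae Q, forall w, X w = c}.
Proof.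
move=> mX mZ XZ /ae_cstP -/(_ mZ) Zc; apply/ae_cstP => //.
by rewrite XZ//; exact: measurable_plane1.
Qed.

End almost_sure.

Section levy_characteristic.
Context {d : measure_display} {T : measurableType d} {R : realType}.
Variables (Q : probability T R) (Y : R -> T -> R[i]).
Hypothesis levyY : levy_process Q Y.

Local Notation M t x := (char_sqr Q (Y t) x).

(** Y_(s+t) is the sum of Y_s and of an independent increment distributed
    as Y_t. *)
Lemma levy_char_sqrD s t x : 0 <= s -> 0 < t -> M (s + t) x = M s x * M t x.
Proof.
move=> s0 t0; have t0' := ltW t0; have st0 : 0 <= s + t by rewrite addr_ge0.
have mY r : 0 <= r -> complex_rv (Y r) by move=> r0; exact: levy_rv levyY _ r0.
have mI : complex_rv (fun w => Y (s + t) w - Y s w) by apply: complex_rvB; exact: mY.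
have -> : Y (s + t) = fun w => Y s w + (Y (s + t) w - Y s w).
  by apply/funext => w; rewrite [RHS]addrC subrK.
rewrite char_sqr_independent//; last 2 first.
- exact: mY.
- move=> A B mA mB.
  pose tt i := if i is 0%N then s else s + t.
  have := @levy_independent _ _ _ _ _ levyY 1%N tt.
  move=> /(_ s0); have ht : forall i, (i < 1)%N -> tt i < tt i.+1.
    by case=> [|//] _ /=; rewrite ltrDl.
  move=> /(_ ht (fun i => if i == ord0 then A else B)) ind.
  rewrite big_ord_recl big_ord1 /= in ind.
  rewrite -ind; last by move=> i; case: ifP.
  congr (Q _); apply/seteqP; split => w /=.
    move=> [Aw Bw] i _; case: (unliftP ord0 i) => [j ->|->] //=.
    by rewrite [j]ord1.
  by move=> h; split; [exact: (h ord0 I)|exact: (h (lift ord0 ord0) I)].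
congr (_ * _); apply: same_law_char_sqr => //; first exact: mY.
exact: levy_stationary.
Qed.

Lemma levy_char_sqr_le s t x : 0 <= s -> s <= t -> M t x <= M s x.
Proof.
move=> s0; rewrite le_eqVlt => /predU1P[-> //|st].
rewrite -[t](subrK s) addrC levy_char_sqrD ?subr_gt0// ler_piMr ?char_sqr_ge0//.
by apply: char_sqr_le1; apply: levy_rv levyY _ _; rewrite subr_ge0 ltW.
Qed.

(** Past time [j], each unit of time contributes a factor [M 1 x], and the
    leftover factor is at most 1. *)
Lemma levy_char_sqr_pow (j : nat) t x : j%:R <= t -> M t x <= M 1 x ^+ j.
Proof.
elim: j t => [|j IH] t jt; first by rewrite expr0 char_sqr_le1//; exact: levy_rv levyY _ jt.
have jt1 : j%:R <= t - 1 by rewrite lerBrDr -natr1 in jt *.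
rewrite -[t](subrK 1) levy_char_sqrD//; last exact: le_trans jt1.
by rewrite exprSr ler_pM ?char_sqr_ge0// IH.
Qed.

Lemma levy_char_sqrMn (k : nat) t x : 0 < t -> M (k.+1%:R * t) x = M t x ^+ k.+1.
Proof.
move=> t0; elim: k => [|k IH]; first by rewrite mul1r expr1.
by rewrite -natr1 mulrDl mul1r levy_char_sqrD// ?IH ?exprSr// mulr_ge0// ltW.
Qed.

(** M_t(x) is nonincreasing in t and at most 1, so it is 1 at a time t/k below
    s; then so is its k-th power M_t(x). *)
Lemma levy_char_sqr_eq1 s t x : 0 < s -> 0 < t -> M s x = 1 -> M t x = 1.
Proof.
move=> s0 t0 Ms.
have rv r : 0 <= r -> complex_rv (Y r) by move=> r0; exact: levy_rv levyY _ r0.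
pose k := Num.trunc (t / s).
have ks : t / k.+1%:R <= s.
  rewrite ler_pdivrMr// mulrC -ler_pdivrMr// ltW//.
  by rewrite /k; have := truncnS_gt (t / s).
have Mk : M (t / k.+1%:R) x = 1.
  apply/eqP; rewrite eq_le char_sqr_le1/=; last by apply: rv; rewrite divr_ge0// ltW.
  by rewrite -{1}Ms levy_char_sqr_le// divr_ge0// ltW.
by rewrite -[t](divfK (_ : k.+1%:R != 0))// mulrC levy_char_sqrMn ?divr_gt0// Mk expr1n.
Qed.

End levy_characteristic.

(** * Levy processes that scale under a group with a contraction *)

Section stable_levy.
Context {d : measure_display} {T : measurableType d} {R : realType}.
Variables (Q : probability T R) (Y : R -> T -> R[i]).
Hypothesis levyY : levy_process Q Y.
Variables (alpha : R) (U : set R[i]).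
Hypothesis U1 : U 1.
Hypothesis UM : forall u v, U u -> U v -> U (u * v).
Hypothesis UV : forall u, U u -> U u^-1.
Hypothesis U_neq0 : forall u, U u -> u != 0.
Hypothesis scaleY : forall (u : R[i]) (t : R), U u -> 0 < t ->
  same_law Q (fun w => u * Y t w) (Y (modulus u `^ alpha * t)).
Variable c : R[i].
Hypothesis Uc : U c.
Hypothesis c1 : modulus c < 1.

Local Notation M t x := (char_sqr Q (Y t) x).

Let mY t : 0 <= t -> complex_rv (Y t).
Proof. by move=> t0; exact: levy_rv levyY _ t0. Qed.

Let UX u n : U u -> U (u ^+ n).
Proof. by move=> Uu; elim: n => [|n IH]; rewrite ?expr0// exprS; exact: UM. Qed.

Let scale_gt0 u t : U u -> 0 < t -> 0 < modulus u `^ alpha * t.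
Proof. by move=> Uu t0; rewrite mulr_gt0// powR_gt0// modulus_gt0 U_neq0. Qed.

Lemma scale_char_sqr u t x : U u -> 0 < t ->
  M (modulus u `^ alpha * t) x = M t (conjc u * x).
Proof.
move=> Uu t0; rewrite -char_sqrM; apply/esym/same_law_char_sqr; last exact: scaleY.
- by apply: complex_rvM; apply: mY; exact: ltW.
- by apply: mY; rewrite ltW// scale_gt0.
Qed.

(** The frequencies [x] for which <x, Y_t> is deterministic, at time 1 and hence
    at all times ([degenerate_freq_dot]). *)
Definition degenerate_freq (x : R[i]) := M 1 x = 1.

Lemma degenerate_freq_conjM u x : U u -> degenerate_freq x -> degenerate_freq (conjc u * x).
Proof.
move=> Uu Hx; rewrite /degenerate_freq -scale_char_sqr//.
by apply: (@levy_char_sqr_eq1 _ _ _ _ _ levyY 1) => //; exact: scale_gt0.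
Qed.

(** Frequencies c^n^* x are degenerate for all n, so outside a null set
    exp(i <x, c^n Y_t>) takes one value for each n. Comparing with a fixed
    outcome [w0] gives the hypothesis of [dot_contraction_eq0]. *)
Lemma degenerate_freq_dot x t : degenerate_freq x -> 0 < t ->
  exists k, {ae Q, forall w, dot x (Y t w) = k}.
Proof.
move=> Hx t0; have rv := mY (ltW t0).
have H n : {ae Q, forall w,
    cos (dot x (c ^+ n * Y t w)) = char_cos Q (Y t) (conjc (c ^+ n) * x) /\
    sin (dot x (c ^+ n * Y t w)) = char_sin Q (Y t) (conjc (c ^+ n) * x)}.
  have : M t (conjc (c ^+ n) * x) = 1.
    apply: (@levy_char_sqr_eq1 _ _ _ _ _ levyY 1) => //.
    exact: degenerate_freq_conjM (UX n Uc) Hx.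
  by move=> /(char_sqr_eq1 rv); apply: filterS => w; rewrite dotMr.
move/ae_foralln in H.
have [w0 hw0] := ae_exists H.
exists (dot x (Y t w0)); apply: filterS H => w hw.
apply/eqP; rewrite -subr_eq0 -dotBr; apply/eqP.
apply: (@dot_contraction_eq0 _ _ c) => // [|n]; first exact: U_neq0.
rewrite mulrBr dotBr cosB; have [-> ->] := hw n; have [<- <-] := hw0 n.
by rewrite -!expr2 cos2Dsin2.
Qed.

Lemma degenerate_freq_comb (a b : R) x y : degenerate_freq x -> degenerate_freq y ->
  degenerate_freq ((a%:C)%C * x + (b%:C)%C * y).
Proof.
move=> /degenerate_freq_dot/(_ ltr01)[k hk] /degenerate_freq_dot/(_ ltr01)[l hl].
apply: (@char_sqr_cst _ _ _ _ _ _ (a * k + b * l)); last exact: mY.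
apply: filterS2 hk hl => w <- <-; rewrite /dot.
by case: (x) (y) (Y 1 w) => [? ?] [? ?] [? ?] /=; ring.
Qed.

Hypothesis irreducible : forall V : {pred Rcomplex R}, invariant_subspace U V ->
  V =i pred1 0 \/ V =i predT.

(** The orthogonal complement [V] of the degenerate frequencies is invariant. It
    does not contain [x], so it is 0; in particular it misses i x, which gives a
    second degenerate frequency that is independent of [x]. *)
Lemma degenerate_freq_full x : x != 0 -> degenerate_freq x ->
  forall y, degenerate_freq y.
Proof.
move=> x0 Hx y.
pose V : {pred Rcomplex R} := fun v => `[< forall z, degenerate_freq z -> dot z v = 0 >].
have VP (v : R[i]) : reflect (forall z, degenerate_freq z -> dot z v = 0) ((v : Rcomplex R) \in V).
  exact: asboolP.
have invV : invariant_subspace U V.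
  split.
    split; first by apply/VP => z _; rewrite /dot !mulr0 addr0.
    move=> a v w /VP hv /VP hw; apply/VP => z Hz.
    by rewrite dotDr hw// addr0 dotZr hv// mulr0.
  move=> u v Uu /VP hv; apply/VP => z Hz.
  by rewrite dotMr; apply: hv; exact: degenerate_freq_conjM.
have [V0|VT] := irreducible invV; last first.
  have /VP/(_ x Hx) : (x : Rcomplex R) \in V by rewrite VT.
  by move/eqP; rewrite dotxx sqrf_eq0 modulus_eq0 (negbTE x0).
pose ix : R[i] := (- complex.Im x +i* complex.Re x)%C.
have ix0 : ix != 0.
  by apply: contra x0; rewrite /ix; case: (x) => a b; rewrite !eq_complex /= oppr_eq0 andbC.
have [z Hz zx] : exists2 z, degenerate_freq z & dot z ix != 0.
  apply: contrapT => no; move: ix0; apply/negP; rewrite negbK.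
  have : (ix : Rcomplex R) \in V.
    by apply/VP => z Hz; apply/eqP; apply: contrapT => /negP zx; apply: no; exists z.
  by rewrite V0.
(* Cramer's rule in the basis x, z. *)
have -> : y = (((dot ((- complex.Im z +i* complex.Re z)%C) y / - dot z ix))%:C)%C * x +
    ((dot ix y / dot z ix)%:C)%C * z.
  move: zx; rewrite /ix /dot; case: (x) (y) (z) => [x1 x2] [y1 y2] [z1 z2] /= zx.
  by apply/eqP; rewrite eq_complex /=; apply/andP; split; apply/eqP; field;
    move: zx; rewrite ?oppr_eq0.
exact: degenerate_freq_comb.
Qed.

Hypothesis nondegY : ~ (forall t, 0 <= t -> {ae Q, forall w, Y t w = 0}).

(** Otherwise all frequencies are degenerate and Y_t = b_t is deterministic.
    Then b is additive in t and small near 0, hence collinear with some nonzero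
    b_(t1); as u b_t = b_(|u|^alpha t), the line through b_(t1) is invariant,
    against irreducibility. *)
Lemma char_sqr_lt1 x : x != 0 -> M 1 x < 1.
Proof.
move=> x0; rewrite lt_def [_ <= _]char_sqr_le1 ?andbT; last exact: mY.
rewrite eq_sym; apply/negP => /eqP Hx; have H := degenerate_freq_full x0 Hx.
have cst t : exists b, 0 <= t -> {ae Q, forall w, Y t w = b}.
  have [->|tn0] := eqVneq t 0; first by exists 0 => _; exact: levy_start levyY.
  have [t0|t0] := boolP (0 <= t); last by exists 0.
  have {tn0}t0 : 0 < t by rewrite lt_def tn0.
  have [k1 hk1] := degenerate_freq_dot (H 1) t0.
  have [k2 hk2] := degenerate_freq_dot (H 'i%C) t0.
  exists (k1 +i* k2)%C => _; apply: filterS2 hk1 hk2 => w <- <-.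
  by rewrite /dot; case: (Y t w) => [a b] /=; rewrite !mul1r !mul0r addr0 add0r.
have /choice[b hb] := cst.
have uniq (X : T -> R[i]) (v v' : R[i]) :
    {ae Q, forall w, X w = v} -> {ae Q, forall w, X w = v'} -> v = v'.
  by move=> hv hv'; have [w [<- <-]] := ae_exists (filterI hv hv').
have b0 : b 0 = 0 by apply: (uniq (Y 0)); [exact: hb|exact: levy_start levyY].
have bD s t : 0 <= s -> 0 <= t -> b (s + t) = b s + b t.
  move=> s0 t0; have st0 : 0 <= s + t by rewrite addr_ge0.
  rewrite [RHS]addrC; apply/eqP; rewrite -subr_eq; apply/eqP.
  apply: (uniq (fun w => Y (s + t) w - Y s w)).
    by apply: filterS2 (hb _ st0) (hb _ s0) => w -> ->.
  apply: same_law_ae_cst (levy_stationary levyY s0 t0) (hb _ t0); last exact: mY.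
  by apply: complex_rvB; exact: mY.
have bU u t : U u -> 0 < t -> b (modulus u `^ alpha * t) = u * b t.
  move=> Uu t0; apply: (uniq (fun w => u * Y t w)); last first.
    by apply: filterS (hb _ (ltW t0)) => w ->.
  have ut0 := ltW (scale_gt0 Uu t0).
  apply: same_law_ae_cst (scaleY Uu t0) (hb _ ut0); last exact: mY.
  by apply: complex_rvM; apply: mY; exact: ltW.
have small e : 0 < e -> exists2 dl, 0 < dl & forall s, 0 <= s -> s < dl -> modulus (b s) <= e.
  move=> e0; have := levy_stochastic_continuity levyY (lexx 0) e0.
  move=> /fine_cvgP[_ /cvgrPdist_lt/(_ _ ltr01)] /nbhs_ballP[dl /= dl0 h].
  exists dl => // s s0 sdl; rewrite leNgt; apply/negP => ebs.
  have := h s; rewrite /ball /= sub0r normrN ger0_norm// => /(_ sdl s0).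
  rewrite (_ : Q _ = 1%E) /=; last first.
    apply: ae_measure1.
      by apply: measurable_modulus_gt; [apply: complex_rvB; exact: mY|exact: ltW].
    apply: filterS2 (hb _ s0) (hb _ (lexx 0)) => w /= -> ->.
    by rewrite b0 subr0.
  by rewrite sub0r normrN normr1 ltxx.
have [t1 t10 bt1] : exists2 t1, 0 < t1 & b t1 != 0.
  apply: contrapT => no; apply: nondegY => t t0.
  have -> : 0 = b t; last exact: hb.
  have [->//|tn0] := eqVneq t 0.
  apply/esym/eqP; apply: contrapT => /negP bt; apply: no; exists t => //.
  by rewrite lt_def tn0.
pose ib : R[i] := (- complex.Im (b t1) +i* complex.Re (b t1))%C.
have ib0 : ib != 0.
  by apply: contra bt1; rewrite /ib; case: (b t1) => v w; rewrite !eq_complex /= oppr_eq0 andbC.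
(* [f] is the component of b orthogonal to b_(t1). It is additive and vanishes at
   t1, hence at all multiples of s = t1/(m+1), so it is s-periodic; as it is
   small on [0, s], it is 0. *)
pose f r := dot ib (b r).
have fD s t : 0 <= s -> 0 <= t -> f (s + t) = f s + f t.
  by move=> s0 t0; rewrite /f bD// dotDr.
have fM (k : nat) s : 0 <= s -> f (k%:R * s) = k%:R * f s.
  move=> s0; elim: k => [|k IH]; first by rewrite !mul0r /f b0 /dot !mulr0 addr0.
  by rewrite -natr1 !mulrDl !mul1r fD ?IH// mulr_ge0.
have f0 t : 0 <= t -> f t = 0.
  move=> t0; apply/eqP; rewrite -normr_le0; apply/ler_addgt0Pl => e e0; rewrite addr0.
  have mb : 0 < modulus ib by rewrite modulus_gt0.
  have [dl dl0 hdl] := small (e / modulus ib) (divr_gt0 e0 mb).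
  pose m := Num.trunc (t1 / dl).
  pose s := t1 / m.+1%:R.
  have s0 : 0 < s by rewrite divr_gt0.
  have sdl : s < dl.
    by rewrite /s ltr_pdivrMr// mulrC -ltr_pdivrMr// /m truncnS_gt.
  have fs : f s = 0.
    have : f t1 = 0.
      by rewrite /f /ib /dot; case: (b t1) => ? ? /=; ring.
    have -> : t1 = m.+1%:R * s by rewrite /s mulrC divfK.
    by rewrite fM ?ltW// => /eqP; rewrite mulf_eq0 pnatr_eq0 /= => /eqP.
  pose k := Num.trunc (t / s).
  have /truncn_itv/andP[k1 k2] : 0 <= t / s by rewrite divr_ge0// ltW.
  have r0 : 0 <= t - k%:R * s by rewrite subr_ge0 -ler_pdivlMr.
  have rs : t - k%:R * s < s.
    by rewrite ltrBlDr -[X in X + _]mul1r -mulrDl nat1r -ltr_pdivrMr.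
  have -> : f t = f (t - k%:R * s).
    have ks0 : 0 <= k%:R * s by rewrite mulr_ge0// ltW.
    have fks : f (k%:R * s) = 0 by rewrite fM ?fs ?mulr0// ltW.
    by have := fD _ _ r0 ks0; rewrite subrK fks addr0.
  apply: (le_trans (dot_le_modulus _ _)).
  by rewrite mulrC -ler_pdivlMr// hdl// (lt_trans rs).
pose V : {pred Rcomplex R} := fun v => dot ib v == 0.
have VP (v : R[i]) : ((v : Rcomplex R) \in V) = (dot ib v == 0) by [].
have invV : invariant_subspace U V.
  split.
    split; first by rewrite VP /dot !mulr0 addr0.
    move=> a v w; rewrite !VP => /eqP hv /eqP hw.
    by rewrite dotDr hw// addr0 dotZr hv// mulr0.
  move=> u v Uu; rewrite !VP => /eqP hv.
  have vE : v = ((dot (b t1) v / dot (b t1) (b t1))%:C)%C * b t1.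
    have : dot (b t1) (b t1) != 0 by rewrite dotxx sqrf_eq0 modulus_eq0.
    move: hv; rewrite /ib /dot; case: (b t1) (v) => [p q] [v1 v2] /= hv pq.
    apply/eqP; rewrite eq_complex /=; apply/andP; split; apply/eqP.
      rewrite mul0r subr0; apply: (mulIf pq); rewrite mulrAC divfK//.
      by rewrite -[LHS]addr0 -(mulr0 q) -hv; ring.
    rewrite mul0r addr0; apply: (mulIf pq); rewrite mulrAC divfK//.
    by rewrite -[LHS]subr0 -(mulr0 p) -hv; ring.
  have := f0 _ (ltW (scale_gt0 Uu t10)); rewrite /f bU// vE.
  move: (_ / _) => r; rewrite mulrCA => h.
  suff -> : dot ib ((r%:C)%C * (u * b t1)) = r * dot ib (u * b t1) by rewrite h mulr0.
  by rewrite /dot; case: (u * b t1) (ib) => [? ?] [? ?] /=; ring.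
have [V0|VT] := irreducible invV.
  have : (b t1 : Rcomplex R) \in V.
    by rewrite VP /ib /dot; case: (b t1) => ? ? /=; apply/eqP; ring.
  by rewrite V0 => /eqP b10; move: bt1; rewrite b10 eqxx.
have : (ib : Rcomplex R) \in V by rewrite VT.
by rewrite VP dotxx sqrf_eq0 modulus_eq0 (negbTE ib0).
Qed.

Hypothesis alpha_gt0 : 0 < alpha.

Let rho := (modulus c)^-1.

Let rho_gt1 : 1 < rho.
Proof. by rewrite invf_gt1// modulus_gt0 U_neq0. Qed.

(** In the n-th shell x is c^(-n)^* y with y in the fundamental annulus, where
    M_1 <= q. Hence M_s(x) <= q^j with j the integer part of
    tau = |c|^(-n alpha) s, and q^j (j + 1) <= 1 + q + .. + q^j <= 1/(1 - q)
    bounds this by a multiple of 1/tau. *)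
Lemma char_sqr_shell_decay s : 0 < s -> exists D : R, forall x n,
  rho ^+ n <= modulus x <= rho ^+ n.+1 -> M s x * (rho ^+ n) `^ alpha <= D.
Proof.
move=> s0; have rho0 : 0 < rho := lt_trans ltr01 rho_gt1.
have [q [q0 q1 hq]] := char_sqr_annulus (mY ler01) (ltW rho_gt1) char_sqr_lt1.
exists ((1 - q)^-1 / s) => x n /andP[xn nx].
have rn0 : 0 < rho ^+ n by exact: exprn_gt0.
have cn0 : c ^+ n != 0 by rewrite expf_neq0// U_neq0.
pose y := conjc (c ^+ n) * x.
have my : modulus y = modulus x / rho ^+ n.
  by rewrite modulusM modulus_conj modulusX /rho exprVn invrK mulrC.
have yL : 1 <= modulus y ^+ 2 <= rho ^+ 2.
  have y1 : 1 <= modulus y by rewrite my ler_pdivlMr// mul1r.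
  have y2 : modulus y <= rho by rewrite my ler_pdivrMr// -exprS.
  by rewrite exprn_ege1//= ler_pXn2r// nnegrE ?modulus_ge0// ltW.
have Mq : M 1 y <= q.
  by move: yL; rewrite modulus_sqr => /hq; case: (y).
have xy : x = conjc (c ^- n) * y by rewrite /y mulrA -rmorphM mulVf// rmorph1 mul1r.
have mcn : modulus (c ^- n) = rho ^+ n.
  by rewrite (modulusV cn0) (modulusX c n) /rho exprVn.
pose tau := (rho ^+ n) `^ alpha * s.
have Mtau : M s x = M tau y.
  have := scale_char_sqr y (UV (UX n Uc)) s0; rewrite -xy => <-.
  by rewrite mcn.
have tau0 : 0 <= tau by rewrite mulr_ge0 ?powR_ge0// ltW.
pose j := Num.trunc tau.
have /truncn_itv/andP[j1 j2] := tau0.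
have Mj : M s x <= q ^+ j.
  rewrite Mtau; apply: (le_trans (levy_char_sqr_pow levyY y j1)).
  by apply: lerXn2r => //; rewrite nnegrE char_sqr_ge0.
rewrite ler_pdivlMr// -mulrA -/tau.
apply: (@le_trans _ _ (q ^+ j * j.+1%:R)).
  by apply: ler_pM; rewrite ?char_sqr_ge0// ltW.
rewrite -[leRHS]mul1r ler_pdivlMr ?subr_gt0//.
have -> : q ^+ j * j.+1%:R = \sum_(i < j.+1) q ^+ j.
  by rewrite sumr_const card_ord mulr_natr.
apply: (@le_trans _ _ ((\sum_(i < j.+1) q ^+ i) * (1 - q))).
  rewrite ler_wpM2r ?subr_ge0 ?(ltW q1)//; apply: ler_sum => i _.
  by rewrite ler_wiXn2l ?(ltW q1)// -ltnS.
have -> : (\sum_(i < j.+1) q ^+ i) * (1 - q) = 1 - q ^+ j.+1.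
  by rewrite -[RHS]opprB subrX1 -mulNr opprB mulrC.
by rewrite gerBl exprn_ge0.
Qed.

(** Since M_t = M_(t/k)^k, a bound O(|x|^(-alpha)) at time t/k becomes
    O(|x|^(-k alpha)) at time t. The exponent 8 is what the square of the two
    weights asks for: each weight is of order |x|^(-2) at worst. Frequencies with
    0 < |x| < 1 are left out, as the lattice has none. *)
Lemma char_sqr_lattice_decay t : 0 < t -> exists2 B : R, 0 <= B &
  forall x, x = 0 \/ 1 <= modulus x ->
    M t x <= (B * (weight (complex.Re x) * weight (complex.Im x))) ^+ 2.
Proof.
move=> t0; have rho0 : 0 < rho := lt_trans ltr01 rho_gt1.
pose k := Num.trunc (8 / alpha).
have k8 : 8 <= alpha * k.+1%:R.
  by rewrite mulrC -ler_pdivrMr// ltW// truncnS_gt.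
have [D hD] := char_sqr_shell_decay (divr_gt0 t0 (ltr0Sn _ k)).
have Mt x : M t x = M (t / k.+1%:R) x ^+ k.+1.
  rewrite -(levy_char_sqrMn levyY) ?divr_gt0//.
  by rewrite [k.+1%:R * _]mulrC divfK.
have powk (r : R) : 1 <= r -> r ^+ 8 <= (r `^ alpha) ^+ k.+1.
  move=> r1; have r0 : 0 <= r by exact: le_trans r1.
  rewrite -(powR_mulrn 8 r0) -(powR_mulrn k.+1 (powR_ge0 r alpha)) -powRrM.
  exact: ler_powR.
pose E := D ^+ k.+1.
have hE x n : rho ^+ n <= modulus x <= rho ^+ n.+1 -> M t x * rho ^+ (n * 8) <= E.
  move=> xn; have h := hD x n xn; rewrite Mt /E.
  have r1 : 1 <= rho ^+ n by rewrite exprn_ege1// ltW.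
  apply: (@le_trans _ _ ((M (t / k.+1%:R) x * (rho ^+ n) `^ alpha) ^+ k.+1)).
    rewrite exprMn ler_wpM2l ?exprn_ge0 ?char_sqr_ge0//.
    rewrite exprM; exact: powk.
  have h0 : 0 <= M (t / k.+1%:R) x * (rho ^+ n) `^ alpha.
    by rewrite mulr_ge0 ?char_sqr_ge0 ?powR_ge0.
  by apply: lerXn2r => //; rewrite nnegrE (le_trans h0).
(* In the n-th shell P := (1 + x1^2)(1 + x2^2) <= 4 rho^(4(n+1)), so
   P^2 <= 16 rho^8 rho^(8n); the maximum with 1 takes care of x = 0. *)
pose B := Num.max 1 (16 * E * rho ^+ 8).
have B1 : 1 <= B by rewrite le_max lexx.
have BE : 16 * E * rho ^+ 8 <= B by rewrite le_max lexx orbT.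
have B0 : 0 <= B by exact: le_trans B1.
exists B => // x [->|x1].
  rewrite char_sqr0 /weight /= expr0n addr0 invr1 !mulr1.
  by rewrite exprn_ege1.
have [n xn] : exists n, rho ^+ n <= modulus x <= rho ^+ n.+1.
  have [N hN] : exists N, modulus x < rho ^+ N.
    have x0 : 0 < modulus x by exact: lt_le_trans x1.
    have : (1 * rho^-1 ^+ n) @[n --> \oo] --> (0 : R).
      by apply: cvg_geometric; rewrite /rho invrK ger0_norm ?modulus_ge0.
    move=> /cvgrPdist_lt/(_ (modulus x)^-1); rewrite invr_gt0 => /(_ x0)[N _].
    move=> /(_ N (leqnn N)) /=; rewrite sub0r normrN mul1r exprVn ger0_norm ?invr_ge0 ?exprn_ge0 ?(ltW rho0)//.
    by rewrite ltf_pV2 ?posrE ?exprn_gt0// => hN; exists N.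
  elim: N hN => [|N IH] hN; first by move: hN; rewrite expr0 ltNge x1.
  have [/IH//|hx] := ltP (modulus x) (rho ^+ N).
  by exists N; rewrite hx ltW.
have /andP[_ xn1] := xn; have := hE x n xn.
pose P := (1 + complex.Re x ^+ 2) * (1 + complex.Im x ^+ 2).
have P0 : 0 < P by rewrite mulr_gt0// ltr_pwDl// sqr_ge0.
have -> : weight (complex.Re x) * weight (complex.Im x) = P^-1 by rewrite -invfM.
have PL : P <= 4 * (rho ^+ n.+1) ^+ 4.
  have m2 : modulus x ^+ 2 <= (rho ^+ n.+1) ^+ 2.
    by rewrite ler_pXn2r ?nnegrE ?modulus_ge0 ?exprn_ge0 ?(ltW rho0).
  have r2 : 1 <= (rho ^+ n.+1) ^+ 2 by rewrite !exprn_ege1 ?(ltW rho_gt1)// exprn_ege1 ?(ltW rho_gt1).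
  move: m2 r2; rewrite modulus_sqr /P (_ : (rho ^+ n.+1) ^+ 4 = ((rho ^+ n.+1) ^+ 2) ^+ 2); last first.
    exact: (exprM _ 2 2).
  move: ((rho ^+ n.+1) ^+ 2) => r; have := sqr_ge0 (complex.Re x); have := sqr_ge0 (complex.Im x).
  move: (complex.Re x ^+ 2) (complex.Im x ^+ 2) => a b a0 b0 abr r1.
  apply: (@le_trans _ _ ((2 * r) * (2 * r))); first by apply: ler_pM; lra.
  by rewrite expr2; lra.
move=> hEx; rewrite exprMn [P^-1 ^+ 2]exprVn ler_pdivlMr ?exprn_gt0//.
have PL2 : P ^+ 2 <= 16 * rho ^+ 8 * rho ^+ (n * 8).
  rewrite (_ : 16 * _ * _ = (4 * (rho ^+ n.+1) ^+ 4) ^+ 2).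
    by rewrite ler_pXn2r ?nnegrE ?(ltW P0)// (le_trans (ltW P0)).
  rewrite exprMn -!exprM -mulrA -exprD; congr (_ * _); first by lra.
  by congr (_ ^+ _); rewrite -mulSn -mulnA.
apply: (@le_trans _ _ (M t x * (16 * rho ^+ 8 * rho ^+ (n * 8)))).
  by rewrite ler_wpM2l ?char_sqr_ge0.
rewrite (_ : M t x * _ = 16 * rho ^+ 8 * (M t x * rho ^+ (n * 8))); last by ring.
apply: (@le_trans _ _ B); last by rewrite -[leLHS]mulr1 expr2 ler_wpM2l.
apply: (le_trans _ BE).
rewrite (_ : 16 * E * rho ^+ 8 = 16 * rho ^+ 8 * E); last by ring.
by rewrite ler_wpM2l// mulr_ge0// exprn_ge0// ltW.
Qed.

Lemma levy_law_dominated t : 0 < t -> law Q (Y t) `<< plane_lebesgue.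
Proof.
move=> t0; have [B B0 hB] := char_sqr_lattice_decay t0.
apply: (lattice_decay_dominated (mY (ltW t0)) B0) => k l.
apply: hB; have [->|k0] := eqVneq k 0; have [->|l0] := eqVneq l 0; first by left.
all: right.
all: rewrite -(@ler_pXn2r _ 2%N) ?nnegrE ?modulus_ge0// expr1n modulus_sqr /=.
all: have sq (z : int) : z != 0 -> 1 <= z%:~R ^+ 2 :> R.
all: try by move=> z0; rewrite -rmorphXn /= ler1z -gtz0_ge1 exprn_even_gt0.
- by rewrite mulr0z expr0n add0r sq.
- by rewrite mulr0z expr0n addr0 sq.
- by apply: (le_trans (sq _ k0)); rewrite lerDl sqr_ge0.
Qed.

End stable_levy.

(** * A contraction in the group generated by the weights *)

Section nonunitary_weight.
Context {d : measure_display} {T : measurableType d} {R : realType}.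
Variables (P : probability T R) (W : nat -> T -> R[i]).
Hypothesis weightsW : weight_family P W.

Let mW j : (1 <= j)%N -> complex_rv (W j). Proof. by move=> j1; exact: weightsW.1. Qed.

Let measurable_nonzero j : measurable [set w | nonzero_indices W w j].
Proof.
have [->|j0] := posnP j.
  rewrite (_ : [set w | _] = set0)//.
  by apply/seteqP; split => w //= [].
rewrite (_ : [set w | _] = ~` ((plane \o W j) @^-1` [set plane 0])).
  apply: measurableC; rewrite -[X in measurable X]setTI.
  by apply: (mW j0) => //; exact: measurable_plane1.
apply/seteqP; split => w /=.
  by move=> [_ /eqP Wj] h; apply: Wj; exact: plane_inj h.
by move=> h; split => //; apply/eqP => Wj; apply: h; rewrite Wj.
Qed.

(** Measurability of [num_nonzero] comes from this series. *)
Let num_nonzeroE w :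
  num_nonzero W w = (\sum_(0 <= j <oo) (\1_[set w | nonzero_indices W w j] w)%:E)%E.
Proof.
rewrite /num_nonzero counting_dirac; apply: eq_eseriesr => j _.
by rewrite diracE indicE; congr ((_ : bool)%:R%:E); apply/idP/idP; rewrite !inE.
Qed.

Let measurable_num_nonzero : measurable_fun setT (num_nonzero W).
Proof.
rewrite (_ : num_nonzero W = fun w =>
  (\sum_(0 <= j <oo | j \in xpredT) (\1_[set w | nonzero_indices W w j] w)%:E)%E).
  apply: ge0_emeasurable_sum => [j w _ _|j _]; first by rewrite lee_fin.
  exact/measurable_EFinP/measurable_indic/measurable_nonzero.
by apply/funext => w; exact: num_nonzeroE.
Qed.

(** Without an element of modulus less than 1, inverses force all moduli to be 1,
    so almost surely the sum that defines [moment] has a 1 for each nonzero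
    weight and its integral is E[N]. *)
Lemma weight_group_contraction (alpha : R) :
  (1 < \int[P]_w num_nonzero W w)%E -> moment P W alpha = 1%E ->
  exists2 c, weight_group P W c & modulus c < 1.
Proof.
move=> N1 m1; apply: contrapT => no.
have [U1 UM UV [F _ UF]] := closed_subgroup_weight_group weightsW.
have U0 u : weight_group P W u -> u != 0 by rewrite UF => -[].
have Umod u : weight_group P W u -> modulus u = 1.
  move=> Uu; apply/eqP; rewrite eq_le; apply/andP; split; rewrite leNgt; apply/negP => h.
    apply: no; exists u^-1; first exact: UV.
    by rewrite modulusV ?U0// invf_lt1// (lt_trans ltr01).
  by apply: no; exists u.
suff : moment P W alpha = (\int[P]_w num_nonzero W w)%E.
  by rewrite m1 => h; move: N1; rewrite -h ltxx.
pose S (j : nat) := [set w | (j%:R%:E <= num_nonzero W w)%E && (1 <= j)%N].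
have mS j : measurable (S j).
  have [->|j0] := posnP j.
    by rewrite (_ : S _ = set0)//; apply/seteqP; split => w //=; rewrite /S /= andbF.
  rewrite (_ : S j = setT `&` [set w | (cst j%:R%:E w <= num_nonzero W w)%E]).
    by apply: measurable_lee => //; exact: measurable_cst.
  by rewrite setTI; apply/seteqP; split => w /=; rewrite /S /= j0 andbT.
pose h (j : nat) : T -> \bar R := (fun w => (modulus (W j w) `^ alpha)%:E) \_ (S j).
have hE j w : (if (j%:R%:E <= num_nonzero W w)%E && (1 <= j)%N
    then (modulus (W j w) `^ alpha)%:E else 0%E) = h j w.
  by rewrite /h patchE mem_setE.
have h0 j w : (0 <= h j w)%E by rewrite -hE; case: ifP => // _; rewrite lee_fin powR_ge0.
have -> : moment P W alpha = (\int[P]_w \sum_(0 <= j <oo | j \in xpredT) h j w)%E.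
  apply: eq_integral => w _; rewrite eseries_cond eseries_mkcond.
  by apply: eq_eseriesr => j _; exact: hE.
apply: ge0_ae_eq_integral => //.
- apply: ge0_emeasurable_sum => [j w _ _|j _]; first exact: h0.
  have [j0|j0] := posnP j.
    rewrite (_ : h j = cst 0%E); first exact: measurable_cst.
    by apply/funext => w; rewrite -hE j0 andbF.
  apply/(measurable_restrictT _ (mS j)); apply: measurable_funTS.
  apply/measurable_EFinP.
  apply: (measurableT_comp (measurable_powR alpha)).
  rewrite (_ : (fun w => _) = fun w => Num.sqrt (dot (W j w) (W j w))); last first.
    by apply/funext => w; rewrite dotxx sqrtr_sqr ger0_norm// modulus_ge0.
  apply: measurableT_comp; first by apply: continuous_measurable_fun; exact: sqrt_continuous.
  have /measurable_fun_pairP[X1 X2] := mW j0.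
  by apply: measurable_funD; apply: measurable_funM.
- by move=> w _; apply: nneseries_ge0 => j _ _; exact: h0.
have cU := contains_weights_weight_group weightsW.
apply: filterS2 weightsW.2 cU => w [wE wfin] wU _.
rewrite num_nonzeroE; apply: eq_eseriesr => j _; rewrite -hE indicE.
case: ifPn => [/andP[jN j1]|jN].
  have Uj := wU _ j1 jN.
  by rewrite Umod// powR1 mem_set//; split => //; exact: U0.
rewrite memNset// => -[j1 Wj]; move: jN; rewrite j1 andbT wE => /negP; apply.
by apply: ereal_sup_ubound; exists j => //; right.
Qed.

End nonunitary_weight.

(** * Absolute continuity *)

Theorem proposition2p2 (R : realType)
    (d : measure_display) (Omega : measurableType d) (P : probability Omega R)
    (W : nat -> Omega -> R[i]) (alpha : R)
    (d' : measure_display) (Omega' : measurableType d') (Q : probability Omega' R)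
    (Y : R -> Omega' -> R[i]) :
  weight_family P W ->
  (1 < \int[P]_w num_nonzero W w)%E ->
  0 < alpha <= 2 ->
  moment P W alpha = 1%E ->
  levy_process Q Y ->
  ~ (forall t, 0 <= t -> {ae Q, forall w, Y t w = 0}) ->
  (forall (u : R[i]) (t : R), weight_group P W u -> 0 < t ->
     same_law Q (fun w => u * Y t w) (Y (modulus u `^ alpha * t))) ->
  (forall V : {pred Rcomplex R}, invariant_subspace (weight_group P W) V ->
     V =i pred1 0 \/ V =i predT) ->
  forall t : R, 0 < t -> law Q (Y t) `<< plane_lebesgue.
Proof.
move=> weightsW N1 /andP[alpha0 _] m1 levyY nondegY scaleY irreducible t t0.
have [U1 UM UV [F _ UF]] := closed_subgroup_weight_group weightsW.
have U0 u : weight_group P W u -> u != 0 by rewrite UF => -[].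
have [c Uc c1] := weight_group_contraction weightsW N1 m1.
exact: (levy_law_dominated levyY U1 UM UV U0 scaleY Uc c1 irreducible nondegY alpha0).
Qed.
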